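(* Let $r\in\{1,2,\dots\}$, $1\le p\le\infty$, $1\le s<\infty$, $\mu>2r-1/s+1/2$. Let $f$ belong to the class $L^\mu_{s,2}$ (that is, $\|f\|_{s,\mu}\le1$), and let the perturbed coefficients satisfy $\|(\langle f-f^\delta,\varphi_{k,j}\rangle)_{k,j\ge0}\|_{\ell_p}\le\delta$, $0<\delta<1$. Then for $n\asymp\left(\delta^{-1}\ln^{1/p-1/s}\frac1\delta\right)^{\frac{1}{\mu-1/p+1/s}}$ the following bound is valid: $$\|f^{(r,r)}-\mathcal D^{(r,r)}_nf^\delta\|_{L_2}\le c\left(\delta\ln^{1/s-1/p}\tfrac1\delta\right)^{\frac{\mu-2r+1/s-1/2}{\mu-1/p+1/s}}\ln^{3/2-1/s}\tfrac1\delta .$$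
   Context: Let $\varphi_k(t)=\sqrt{k+1/2}\,(2^kk!)^{-1}\frac{d^k}{dt^k}[(t^2-1)^k]$, $k=0,1,2,\dots$, be the Legendre polynomials orthonormal on $[-1,1]$, $Q=[-1,1]^2$, $L_2=L_2(Q)$, $\varphi_{k,j}(t,\tau)=\varphi_k(t)\varphi_j(\tau)$, and $\langle f,\varphi_{k,j}\rangle=\int_{-1}^1\int_{-1}^1 f(t,\tau)\varphi_k(t)\varphi_j(\tau)\,d\tau\,dt$. $\ell_p$ is the space of double sequences $(x_{k,j})_{k,j\ge0}$ with norm $(\sum|x_{k,j}|^p)^{1/p}$ (supremum if $p=\infty$). The space $L^\mu_{s,2}$ consists of $f\in L_2(Q)$ with $\|f\|_{s,\mu}^s:=\sum_{k,j\ge0}(\underline{k\cdot j})^{s\mu}|\langle f,\varphi_{k,j}\rangle|^s<\infty$, where $\underline{m}=\max\{1,m\}$; the class $L^\mu_{s,2}$ is its unit ball. The mixed derivative is understood as the series $f^{(r,r)}(t,\tau)=\sum_{k,j\ge r}\langle f,\varphi_{k,j}\rangle\varphi_k^{(r)}(t)\varphi_j^{(r)}(\tau)$. The perturbed coefficients $\langle f^\delta,\varphi_{k,j}\rangle$, $k,j\ge0$, are a sequence of numbers, known in place of the exact coefficients, satisfying the stated $\ell_p$ condition, where $\langle f-f^\delta,\varphi_{k,j}\rangle$ denotes the difference of the exact and perturbed coefficients. The truncation method is $$\mathcal D_n^{(r,r)}f^\delta(t,\tau)=\sum_{k,j\ge r,\ kj\le rn-1}\langle f^\delta,\varphi_{k,j}\rangle\varphi_k^{(r)}(t)\varphi_j^{(r)}(\tau).$$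 For positive quantities, $a\preceq b$ means $a\le c'b$ for some constant $c'>0$, and $a\asymp b$ means $a\preceq b$ and $b\preceq a$. The constant $c>0$ in the bound may depend only on basic parameters such as $\mu,r,p,s$. $\ln^ax=(\ln x)^a$.
   Formalization: The bound is stated for 0<δ≤δ0 with any fixed δ0<1, and c may also depend on δ0 and on the constants in n≍…; uniformly up to δ→1 it fails (p=s=2, r=1, μ=4, n=2, f=0, single perturbed coefficient δ at (1,1)). *)

(* Defs.v *)
From HB Require Import structures.
From mathcomp Require Import all_boot all_order all_algebra finmap.
From mathcomp Require Import all_classical all_reals all_analysis.

Set Implicit Arguments.
Unset Strict Implicit.
Unset Printing Implicit Defensive.

Import Order.TTheory GRing.Theory Num.Theory.
Import numFieldNormedType.Exports.

Local Open Scope classical_set_scope.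
Local Open Scope ring_scope.

Section defs.
Variable R : realType.

Definition square : set (R * R) := `[-1, 1] `*` `[-1, 1].

(* Elements of L_2(Q) are represented by functions on the whole plane, of which
   only the restriction to Q matters: [f \_ square] is the extension by 0. *)
Definition L2norm (f : R * R -> R) : \bar R :=
  ('N[(@lebesgue_measure R \x @lebesgue_measure R)%E]_2%:E
     [EFin \o (f \_ square)])%E.

Definition in_L2 (f : R * R -> R) : Prop :=
  f \_ square \in Lfun (@lebesgue_measure R \x @lebesgue_measure R)%E 2%:E.

(* Rodrigues' formula. *)
Definition legendre (k : nat) : {poly R} :=
  (Num.sqrt (k%:R + 2^-1) / (2 ^+ k * (k`!)%:R)) *: (('X^2 - 1) ^+ k)^`(k).

Definition legendre_derivn (r k : nat) (t : R) : R := (legendre k)^`(r).[t].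

Definition fcoef (f : R * R -> R) (k j : nat) : R :=
  \int[lebesgue_measure]_(t in `[-1, 1])
    \int[lebesgue_measure]_(tau in `[-1, 1])
      (f (t, tau) * (legendre k).[t] * (legendre j).[tau]).

(* Only used for 1 <= p <= +oo; the last branch is a dummy value. *)
Definition ell_norm (p : \bar R) (x : nat -> nat -> R) : \bar R :=
  match p with
  | q%:E =>
      ((\esum_(i in [set: nat * nat]) (`|x i.1 i.2| `^ q)%:E) `^ q^-1)%E
  | +oo%E => ereal_sup [set `|x i.1 i.2|%:E | i in [set: nat * nat]]
  | -oo%E => 0%E
  end.

Definition smooth_norm (s mu : R) (f : R * R -> R) : \bar R :=
  ((\esum_(i in [set: nat * nat])
      ((maxn 1 (i.1 * i.2))%:R `^ (s * mu) * `|fcoef f i.1 i.2| `^ s)%:E)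
    `^ s^-1)%E.

Definition smooth_class (s mu : R) (f : R * R -> R) : Prop :=
  in_L2 f /\ (smooth_norm s mu f <= 1)%E.

(* [g] is the sum of the series defining the mixed derivative f^(r,r), the
   double series being summed unconditionally in the norm of L_2(Q), i.e. along
   the finite sets of indices directed by inclusion. *)
Definition is_mixed_derivative (r : nat) (f g : R * R -> R) : Prop :=
  in_L2 g /\
  forall e : R, 0 < e ->
  exists F0 : {fset nat * nat}, forall F : {fset nat * nat}, (F0 `<=` F)%fset ->
    (L2norm (fun z => (g z -
       \sum_(i <- F | (r <= i.1)%N && (r <= i.2)%N)
          fcoef f i.1 i.2 * legendre_derivn r i.1 z.1
                          * legendre_derivn r i.2 z.2)%R)
     <= e%:E)%E.

(* For r, n >= 1 the range bounds k, j < r * n lose nothing, since k, j >= 1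
   and k * j <= r * n - 1 force k, j <= r * n - 1. *)
Definition truncation (r n : nat) (x : nat -> nat -> R) (z : R * R) : R :=
  \sum_(r <= k < r * n) \sum_(r <= j < r * n | (k * j <= r * n - 1)%N)
     x k j * legendre_derivn r k z.1 * legendre_derivn r j z.2.

(* 1/p, with 1/+oo = 0 *)
Definition recip (p : \bar R) : R := fine (p^-1)%E.

End defs.

(* Main.v *)
(* Write [a_kj] for the coefficients of [f], [b = 2r - 1/2] and [N = rn].  The
   triangle inequality in [L_2(Q)] suffices.  Repeated integration by parts turns
   the squared norm of [phi_k^(r)] into boundary terms
   [phi_k^(r+i)(+-1) phi_k^(r-1-i)(+-1)], each of order [k^(4r-1)] by Rodrigues'
   formula, plus [(phi_k, phi_k^(2r)) = 0]; hence [phi_k^(r) phi_j^(r)] has norm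
   [O((kj)^b)].  It remains to sum [|a_kj| (kj)^b] over [kj >= N] (truncation
   error) and [|a_kj - a^delta_kj| (kj)^b] over [kj < N] (propagated noise), using
   that [sum_(kj >= N) (kj)^(-1-c) = O(N^(-c) ln N)] and that [O(N ln N)] pairs
   satisfy [kj < N].  Both contributions are even of order
   [ln^(1 - 1/s) (1/delta)], which is better than the exponent [3/2 - 1/s]. *)
Require Import Defs.
From mathcomp Require Import all_boot all_order all_algebra finmap.
From mathcomp Require Import all_classical all_reals all_analysis.
From mathcomp Require Import measurable_realfun.
From mathcomp Require Import ring lra zify.
Set Implicit Arguments.
Unset Strict Implicit.
Unset Printing Implicit Defensive.

Import Order.TTheory GRing.Theory Num.Theory.
Import numFieldNormedType.Exports.
Local Open Scope ring_scope.

(** * Powers, harmonic sums and the hyperbolic cross *)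

(** Put [q = mu - b + 1/s - 1] and [kappa = mu - 1/p + 1/s]. The truncation error is of order N^(-q)
    ln^(1-1/s) N, the noise of order delta N^(b+1-1/p) ln^(1-1/p) N. Up to constants the two agree
    when N^kappa is delta^(-1) times ln^(1/p-1/s) (1/delta), which is the origin of the prescribed
    n; the hypothesis on mu says exactly that q > 0. The mixed derivative is accessible only as a
    limit along finite index sets. Every sum is therefore estimated over duplicate-free lists of
    pairs, with constants that do not depend on the list. The tail bound with N = 1 also gives
    absolute summability of the series, hence existence of the derivative. *)

Section sums.
Variable R : realType.
Implicit Types (x y a b c : R) (N M k j : nat).

Lemma le_powRN c x y : 0 <= c -> 0 < x -> x <= y -> y `^ (- c) <= x `^ (- c).
Proof.
move=> c0 x0 xy; rewrite !powRN lef_pV2 ?posrE ?powR_gt0 ?(lt_le_trans x0) //.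
by apply: ge0_ler_powR; rewrite ?nnegrE ?(ltW x0) ?(le_trans (ltW x0) xy).
Qed.

(* This two-term form of Young's inequality replaces Hoelder's inequality: it is
   summed over the index and [l] is optimized afterwards. *)
Lemma le_powR_young (p l u : R) : 1 <= p -> 0 < l -> 0 <= u ->
  u <= l + l `^ (1 - p) * u `^ p.
Proof.
move=> p1 l0 u0; have [ul|lu] := leP u l.
  by rewrite (le_trans ul) // lerDl mulr_ge0 ?powR_ge0.
have u1 : 0 < u by exact: lt_trans lu.
rewrite -[leLHS]add0r lerD ?(ltW l0) //.
rewrite -[u `^ p]mulr_powRB1 ?(lt_le_trans _ p1) // mulrCA ler_peMr //.
rewrite -[1 - p]opprB powRN ler_pdivlMl ?powR_gt0 // mulr1.
by apply: ge0_ler_powR; rewrite ?subr_ge0 ?nnegrE // ltW.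
Qed.

Lemma sum_uniq_le (T : eqType) (s1 s2 : seq T) (f : T -> R) :
  (forall i, 0 <= f i) -> uniq s1 -> {subset s1 <= s2} ->
  \sum_(i <- s1) f i <= \sum_(i <- s2) f i.
Proof.
move=> f0; elim: s1 s2 => [|i s1 IH] s2; first by rewrite big_nil sumr_ge0.
move=> /= /andP[is1 us1] s12; have is2 : i \in s2 by rewrite s12 // mem_head.
rewrite big_cons (big_rem i is2) /=.
rewrite lerD2l IH // => j js1; have := s12 j; rewrite inE js1 orbT => /(_ isT).
rewrite [j \in s2](perm_mem (perm_to_rem is2)) inE.
by case: eqP => // ji; rewrite -ji js1 in is1.
Qed.

(** Encloses a finite set of pairs in a square box, so that sums over it can be estimated one
    variable at a time. The later bounds do not depend on [M], so its existence is enough. *)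
Lemma sum_pairs_le (s : seq (nat * nat)) (f : nat -> nat -> R) :
  (forall k j, 0 <= f k j) -> uniq s ->
  (forall i, i \in s -> (0 < i.1)%N && (0 < i.2)%N) ->
  exists M, \sum_(i <- s) f i.1 i.2 <= \sum_(1 <= k < M) \sum_(1 <= j < M) f k j.
Proof.
move=> f0 us s0; exists (\max_(i <- s) (i.1 + i.2).+1)%N.
set M := (\max_(_ <- _) _)%N.
rewrite -(big_allpairs (F := fun i => f i.1 i.2)).
apply: sum_uniq_le => // -[k j] kjs; apply/allpairsP; exists (k, j).
have := s0 _ kjs; rewrite /= !mem_index_iota => /andP[-> ->] /=.
have : ((k + j).+1 <= M)%N.
  exact: (@leq_bigmax_seq _ _ xpredT (fun i => (i.1 + i.2).+1)%N _ kjs).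
by split => //; lia.
Qed.

(** Each new term satisfies 1/(N+1) <= ln (N+1) - ln N, because ln (1 - y) <= -y. The range [M] is
    independent of the cutoff [N] to fit the box of [sum_pairs_le]. *)
Lemma harmonic_le M N : (0 < N)%N ->
  \sum_(1 <= k < M | (k <= N)%N) k%:R^-1 <= 1 + ln N%:R :> R.
Proof.
move=> N0; apply: (@le_trans _ _ (\sum_(1 <= k < N.+1) k%:R^-1)).
  rewrite -big_filter sum_uniq_le ?filter_uniq ?iota_uniq // => k.
  by rewrite mem_filter !mem_index_iota ltnS => /andP[-> /andP[->]].
elim: N N0 => // -[_ _|N IH _]; first by rewrite big_nat1 invr1 ln1 addr0.
rewrite big_nat_recr //=; apply: le_trans (lerD (IH isT) (lexx _)) _.
rewrite -addrA lerD2l -lerBrDl -opprB lerNr -ln_div ?posrE //.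
have -> : N.+1%:R / N.+2%:R = 1 + - N.+2%:R^-1 :> R.
  have : N.+2%:R != 0 :> R by rewrite pnatr_eq0.
  by rewrite -[N.+2%:R]natr1 => ?; field.
apply: le_ln1Dx; rewrite ltrN2 invf_lt1 ?ltr1n //.
Qed.

Lemma powRN1D c x : 0 < x -> x `^ (- (1 + c)) = x^-1 * x `^ (- c).
Proof.
move=> x0; rewrite opprD powRD; last by rewrite (gt_eqF x0) implybT.
by rewrite powR_inv1 ?ltW.
Qed.

(** Integral comparison without an integral: division by (x+1)^(-c) leaves (1 - 1/(x+1))^(-c) >= 1 +
    c/(x+1), which follows from e^y >= 1 + y and ln (1 + y) <= y. *)
Lemma powR_telescope c x : 0 < c -> 0 < x ->
  (x + 1) `^ (- (1 + c)) <= c^-1 * (x `^ (- c) - (x + 1) `^ (- c)).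
Proof.
move=> c0 x0; have y0 : 0 < x + 1 by rewrite addr_gt0.
rewrite ler_pdivlMl // lerBrDl powRN1D //.
have -> : (x + 1) `^ (- c) + c * ((x + 1)^-1 * (x + 1) `^ (- c)) =
    (x + 1) `^ (- c) * (1 + c * (x + 1)^-1) by ring.
have -> : x `^ (- c) = (x + 1) `^ (- c) * (x / (x + 1)) `^ (- c).
  by rewrite -powRM ?divr_ge0 ?(ltW x0) ?(ltW y0) // mulrC divfK ?gt_eqF.
rewrite ler_wpM2l ?powR_ge0 // /powR gt_eqF ?divr_gt0 //.
apply: le_trans (expR_ge1Dx _); rewrite lerD2l mulNr -mulrN ler_wpM2l ?(ltW c0) //.
rewrite lerNr (_ : x / (x + 1) = 1 + - (x + 1)^-1).
  by apply: le_ln1Dx; rewrite ltrN2 invf_lt1 // ltrDr.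
by field; rewrite gt_eqF.
Qed.

(** The threshold is real because it will be N/k. In the constant, c^(-1) comes from telescoping and
    1 pays for the first term above [x], which has no predecessor to telescope against. *)
Lemma powR_tail_le c x M : 0 < c -> 0 < x ->
  \sum_(1 <= j < M | x <= j%:R) j%:R `^ (- (1 + c)) <= (1 + c^-1) * x `^ (- c).
Proof.
move=> c0 x0; have rhs0 : 0 <= (1 + c^-1) * x `^ (- c).
  by rewrite mulr_ge0 ?powR_ge0 // addr_ge0 // invr_ge0 ltW.
case: M => [|M]; first by rewrite big_geq.
(* The induction needs the telescoped remainder c^(-1) M^(-c) on the right; before [M] reaches [x]
   the sum is empty. *)
suff : \sum_(1 <= j < M.+1 | x <= j%:R) j%:R `^ (- (1 + c)) <=
    if x <= M%:R then (1 + c^-1) * x `^ (- c) - c^-1 * M%:R `^ (- c) else 0.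
  move=> /le_trans; apply; case: ifP => // _.
  by rewrite lerBlDr lerDl mulr_ge0 ?powR_ge0 // invr_ge0 ltW.
elim: M => [|M IH]; first by rewrite big_geq // [x <= _]leNgt [_ < x]x0.
rewrite big_mkcond big_nat_recr //= -big_mkcond.
have [xM|Mx] := leP x M.+1%:R; last first.
  by rewrite addr0; move: IH; rewrite [x <= M%:R]leNgt (le_lt_trans _ Mx) ?ler_nat.
have M0 : 0 < M.+1%:R :> R by [].
apply: le_trans (lerD IH (lexx _)) _.
have [xM'|Mx] := leP x M%:R.
  have := powR_telescope c0 (lt_le_trans x0 xM'); rewrite natr1; lra.
rewrite add0r powRN1D //.
have h : M.+1%:R `^ (- c) <= x `^ (- c) by apply: le_powRN; rewrite // ltW.
apply: (@le_trans _ _ (M.+1%:R `^ (- c))).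
  by rewrite ler_piMl ?powR_ge0 // invf_le1 // ler1n.
have : c^-1 * M.+1%:R `^ (- c) <= c^-1 * x `^ (- c) by rewrite ler_wpM2l // invr_ge0 ltW.
lra.
Qed.

End sums.

(** * Pairs below and above the hyperbola kj = N *)

Section hyperbolic.
Variable R : realType.
Implicit Types (N M k j : nat) (s : seq (nat * nat)).

Let pos_pairs s := forall i, i \in s -> (0 < i.1)%N && (0 < i.2)%N.

(** For fixed k at most N/k values of j are possible, and none if k > N, so the count is at most N
    times a harmonic sum. *)
Lemma hyperbolic_count_le s N : (0 < N)%N -> uniq s -> pos_pairs s ->
  (forall i, i \in s -> (i.1 * i.2 < N)%N) ->
  (size s)%:R <= N%:R * (1 + ln N%:R) :> R.
Proof.
move=> N0 us s0 sN; pose f k j : R := (k * j < N)%:R.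
have -> : (size s)%:R = \sum_(i <- s) f i.1 i.2.
  rewrite big_seq_cond (eq_bigr (fun=> 1)) -?big_seq_cond ?sumr_const_seq //.
    by rewrite big_const_seq count_predT iter_addr_0.
  by move=> i; rewrite andbT /f => /sN ->.
have [M] := sum_pairs_le (fun k j => ler0n R _ : 0 <= f k j) us s0.
move=> /le_trans; apply.
apply: (@le_trans _ _ (\sum_(1 <= k < M | (k <= N)%N) N%:R * k%:R^-1)); last first.
  by rewrite -mulr_sumr ler_wpM2l // harmonic_le.
rewrite [leRHS]big_mkcond !big_nat; apply: ler_sum => k /andP[k0 _].
case: leqP => [kN|Nk]; last first.
  rewrite big_nat big1 // => j /andP[j0 _].
  by rewrite /f ltnNge (leq_trans (ltnW Nk)) ?leq_pmulr.
apply: (@le_trans _ _ (\sum_(1 <= j < (N %/ k).+1) 1)).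
  rewrite (eq_bigr (fun j => if (k * j < N)%N then 1 else 0)); last first.
    by move=> j _; rewrite /f; case: ifP.
  rewrite -big_mkcond -big_filter; apply: sum_uniq_le => //.
    by rewrite filter_uniq ?iota_uniq.
  move=> j; rewrite mem_filter !mem_index_iota => /andP[kjN /andP[-> _]] /=.
  by rewrite ltnS leq_divRL // mulnC ltnW.
rewrite sumr_const_nat subn1 /= ler_pdivlMr ?ltr0n // -natrM ler_nat.
exact: leq_trunc_div.
Qed.

Lemma hyperbolic_tail_le (c : R) s N : 0 < c -> (0 < N)%N -> uniq s -> pos_pairs s ->
  (forall i, i \in s -> (N <= i.1 * i.2)%N) ->
  \sum_(i <- s) (i.1 * i.2)%:R `^ (- (1 + c)) <=
  ((1 + c^-1) + (1 + c^-1) ^+ 2) * (N%:R `^ (- c) * (1 + ln N%:R)).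
Proof.
move=> c0 N0 us s0 sN; set C := 1 + c^-1.
have C0 : 0 <= C by rewrite addr_ge0 // invr_ge0 ltW.
have NR0 : 0 < N%:R :> R by rewrite ltr0n.
pose f k j : R := if (N <= k * j)%N then (k * j)%:R `^ (- (1 + c)) else 0.
have f0 k j : 0 <= f k j by rewrite /f; case: ifP => // _; exact: powR_ge0.
have -> : \sum_(i <- s) (i.1 * i.2)%:R `^ (- (1 + c)) = \sum_(i <- s) f i.1 i.2.
  by apply: eq_big_seq => i /sN; rewrite /f => ->.
have [M] := sum_pairs_le f0 us s0.
move=> /le_trans; apply.
(* At k = N both summands are present; this overlap lets the two sums match [harmonic_le] and
   [powR_tail_le] exactly. *)
pose g k : R := C * N%:R `^ (- c) * (if (k <= N)%N then k%:R^-1 else 0) +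
  C * (if N%:R <= k%:R :> R then k%:R `^ (- (1 + c)) else 0).
apply: (@le_trans _ _ (\sum_(1 <= k < M) g k)).
  rewrite !big_nat; apply: ler_sum => k /andP[k0 _].
  have kR0 : 0 < k%:R :> R by rewrite ltr0n.
  have h1 : \sum_(1 <= j < M) f k j <= C * N%:R `^ (- c) * k%:R^-1.
    rewrite (eq_bigr (fun j => if N%:R / k%:R <= j%:R :> R then
        k%:R `^ (- (1 + c)) * j%:R `^ (- (1 + c)) else 0)); last first.
      move=> j _; rewrite /f ler_pdivrMr // -natrM ler_nat [(j * k)%N]mulnC.
      by rewrite natrM powRM //; case: ifP.
    rewrite -big_mkcond -mulr_sumr.
    apply: le_trans (ler_wpM2l (powR_ge0 _ _) (powR_tail_le M c0 (divr_gt0 NR0 kR0))) _.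
    rewrite mulrCA -mulrA ler_wpM2l // powRM ?invr_ge0 // powRN1D //.
    have -> : k%:R^-1 * k%:R `^ (- c) * (N%:R `^ (- c) * k%:R^-1 `^ (- c)) =
        N%:R `^ (- c) * k%:R^-1 * (k%:R `^ (- c) * k%:R^-1 `^ (- c)) by ring.
    by rewrite -powRM ?invr_ge0 // divff ?gt_eqF // powR1 mulr1.
  have h2 : \sum_(1 <= j < M) f k j <= C * k%:R `^ (- (1 + c)).
    apply: (@le_trans _ _ (\sum_(1 <= j < M | 1 <= j%:R :> R)
        k%:R `^ (- (1 + c)) * j%:R `^ (- (1 + c)))).
      rewrite [leRHS]big_mkcond !big_nat; apply: ler_sum => j /andP[j0 _].
      by rewrite ler1n j0 /f natrM powRM //=; case: ifP => // _; rewrite mulr_ge0 ?powR_ge0.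
    rewrite -mulr_sumr.
    apply: le_trans (ler_wpM2l (powR_ge0 _ _) (powR_tail_le M c0 ltr01)) _.
    by rewrite powR1 mulr1 mulrC.
  rewrite /g ler_nat; case: (leqP k N) => kN; case: (leqP N k) => Nk //;
    rewrite ?mulr0 ?addr0 ?add0r //; last by lia.
  by rewrite (le_trans h1) // lerDl mulr_ge0 ?powR_ge0.
rewrite big_split /= -!mulr_sumr -!big_mkcond /=.
have hH := @harmonic_le R M N N0.
have hT := powR_tail_le M c0 NR0.
have L1 : 1 <= 1 + ln N%:R :> R by rewrite lerDl ln_ge0 // ler1n.
rewrite [leRHS]mulrDl; apply: lerD.
  by rewrite -mulrA ler_wpM2l // ler_wpM2l // powR_ge0.
rewrite expr2 -mulrA ler_wpM2l //; apply: le_trans hT _.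
by rewrite ler_wpM2l // ler_peMr ?powR_ge0.
Qed.

End hyperbolic.

(** * Weighted coefficient sums: noise and tail *)

Section weighted.
Variable R : realType.
Implicit Types (t : seq (nat * nat)) (a x : nat -> nat -> R).

Lemma sum_le_esum (T : choiceType) (t : seq T) (f : T -> R) : uniq t ->
  ((\sum_(i <- t) f i)%:E <= \esum_(i in [set: T]%classic) (f i)%:E)%E.
Proof.
move=> ut; apply: esum_ge; exists [set` t]%classic.
  by rewrite /fsets /=; split => //; exact: finite_seq.
by rewrite -fsbig_seq // sumEFin.
Qed.

Lemma poweR_inv_le (x : \bar R) (p y : R) : 0 < p -> 0 <= y -> (0 <= x)%E ->
  (x `^ p^-1 <= y%:E)%E -> (x <= (y `^ p)%:E)%E.
Proof.
move=> p0 y0 x0 xy; rewrite -[leLHS](poweRe1 x0) -(mulVf (lt0r_neq0 p0)) poweRrM -poweR_EFin.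
by apply: gt0_ler_poweR; rewrite ?(ltW p0) ?in_itv /= ?leey ?poweR_ge0 ?lee_fin ?y0.
Qed.

Lemma recip_EFin (p : R) : 0 < p -> recip p%:E = p^-1.
Proof. by move=> p0; rewrite /recip inver gt_eqF. Qed.

Lemma recip_pinfty : recip (+oo%E : \bar R) = 0.
Proof. by rewrite /recip invey. Qed.

(** Hoelder's inequality up to the factor 2. For finite p, [l = delta * M^(-1/p)] makes the two
    Young terms, summed over at most [M] entries, contribute the same bound delta M^(1-1/p). *)
Lemma noise_sum_le (p : \bar R) x (delta M : R) t : (1 <= p)%E -> 0 < delta ->
  (ell_norm p x <= delta%:E)%E -> uniq t -> 0 < M -> (size t)%:R <= M ->
  \sum_(i <- t) `|x i.1 i.2| <= 2 * (delta * M `^ (1 - recip p)).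
Proof.
move=> p1 d0 xd ut M0 tM; case: p p1 xd => [p| |] //=.
- rewrite lee_fin => p1 xd; have p0 : 0 < p by exact: lt_le_trans p1.
  have {xd} xd : \sum_(i <- t) `|x i.1 i.2| `^ p <= delta `^ p.
    rewrite -lee_fin; apply: le_trans (sum_le_esum _ ut) _.
    apply: poweR_inv_le xd => //; first exact: ltW.
    by apply: esum_ge0 => i _; rewrite lee_fin powR_ge0.
  rewrite recip_EFin //; set l := delta * M `^ (- p^-1).
  have l0 : 0 < l by rewrite mulr_gt0 // powR_gt0.
  have lM : l * M = delta * M `^ (1 - p^-1).
    rewrite /l addrC powRD ?(gt_eqF M0) ?implybT // powRr1 ?ltW // mulrA //.
  have lp : l `^ (1 - p) * delta `^ p = delta * M `^ (1 - p^-1).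
    rewrite powRM ?powR_ge0 ?ltW // mulrAC -powRD ?(gt_eqF d0) ?implybT // subrK.
    rewrite powRr1 ?ltW // -powRrM; congr (_ * _ `^ _).
    by field; rewrite gt_eqF.
  apply: (@le_trans _ _ (\sum_(i <- t) (l + l `^ (1 - p) * `|x i.1 i.2| `^ p))).
    by apply: ler_sum => i _; exact: le_powR_young.
  rewrite big_split /= big_const_seq count_predT iter_addr_0 -mulr_sumr.
  rewrite mulr_natl -[in leRHS]lM mulr2n [X in _ <= X + _]mulrC -[l *+ _]mulr_natr.
  rewrite [X in _ <= X + _]mulrC lerD // ?ler_wpM2l ?(ltW l0) //.
  by rewrite lM -lp ler_wpM2l ?powR_ge0.
- move=> _ xd; rewrite recip_pinfty subr0 powRr1 ?(ltW M0) //.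
  apply: (@le_trans _ _ (\sum_(i <- t) delta)).
    apply: ler_sum => i _; rewrite -lee_fin; apply: le_trans xd.
    by apply: ereal_sup_ubound; exists i.
  rewrite big_const_seq count_predT iter_addr_0 -[delta *+ _]mulr_natr.
  apply: (@le_trans _ _ (delta * M)); first by rewrite ler_wpM2l // ltW.
  by rewrite ler_peMl ?ler1n // mulr_ge0 // ltW.
Qed.

(* Young's inequality is applied to [(kj)^mu |a_kj|] with
   [l = (1 + ln N)^(-1/s) (kj)^(-1/s)]: this choice works for all [s >= 1],
   whereas the extremal weights of Hoelder's inequality degenerate at [s = 1]. *)
Lemma tail_sum_le (s mu b c : R) a t N : 1 <= s ->
  c = mu - b + s^-1 - 1 -> 0 < c ->
  (0 < N)%N -> uniq t ->
  (forall i, i \in t -> (0 < i.1)%N && (0 < i.2)%N) ->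
  (forall i, i \in t -> (N <= i.1 * i.2)%N) ->
  \sum_(i <- t) (i.1 * i.2)%:R `^ (s * mu) * `|a i.1 i.2| `^ s <= 1 ->
  \sum_(i <- t) `|a i.1 i.2| * (i.1 * i.2)%:R `^ b <=
  ((1 + c^-1) + (1 + c^-1) ^+ 2 + 1) *
    (N%:R `^ (- c) * (1 + ln N%:R) `^ (1 - s^-1)).
Proof.
move=> s1 cE c0 N0 ut t0 tN at1; set C := _ + _ ^+ 2.
have s0 : 0 < s by exact: lt_le_trans s1.
have NR0 : 0 < N%:R :> R by rewrite ltr0n.
set L := 1 + ln N%:R; have L0 : 0 < L by rewrite ltr_pwDl // ln_ge0 // ler1n.
pose m (i : nat * nat) : R := (i.1 * i.2)%:R.
apply: (@le_trans _ _ (\sum_(i <- t) (L `^ (- s^-1) * m i `^ (- (1 + c)) +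
   L `^ (1 - s^-1) * N%:R `^ (- c) * (m i `^ (s * mu) * `|a i.1 i.2| `^ s)))).
  rewrite !big_seq; apply: ler_sum => i it.
  have m0 : 0 < m i by rewrite ltr0n muln_gt0 t0.
  have Nm : N%:R <= m i by rewrite ler_nat tN.
  pose l := L `^ (- s^-1) * m i `^ (- s^-1).
  have l0 : 0 < l by rewrite mulr_gt0 // powR_gt0.
  have B0 : 0 <= m i `^ mu * `|a i.1 i.2| by rewrite mulr_ge0 ?powR_ge0.
  have mD u v : m i `^ (u + v) = m i `^ u * m i `^ v.
    by rewrite powRD // (gt_eqF m0) implybT.
  have -> : `|a i.1 i.2| * m i `^ b = m i `^ (b - mu) * (m i `^ mu * `|a i.1 i.2|).
    by rewrite mulrA -mD subrK mulrC.
  apply: le_trans (ler_wpM2l (powR_ge0 _ _) (le_powR_young s1 l0 B0)) _.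
  rewrite mulrDr; apply: lerD.
    rewrite /l mulrCA -mD le_eqVlt; apply/orP; left; apply/eqP; congr (_ * _ `^ _).
    by rewrite cE; ring.
  rewrite powRM ?powR_ge0 // -powRrM [mu * s]mulrC !mulrA.
  rewrite ler_wpM2r ?powR_ge0 // ler_wpM2r ?powR_ge0 //.
  rewrite /l powRM ?powR_ge0 // -!powRrM mulrCA -mD.
  have -> : - s^-1 * (1 - s) = 1 - s^-1 by field; rewrite gt_eqF.
  (* The power of kj left in front of the smoothness term is exactly -c, so it is at most N^(-c) on
     the tail. *)
  rewrite ler_wpM2l ?powR_ge0 // (_ : b - mu + (1 - s^-1) = - c); last by rewrite cE; ring.
  by apply: le_powRN; rewrite // ltW.
rewrite big_split /= -!mulr_sumr mulrDl; apply: lerD.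
  apply: le_trans (ler_wpM2l (powR_ge0 _ _) (hyperbolic_tail_le c0 N0 ut t0 tN)) _.
  rewrite -/C -/L mulrCA le_eqVlt; apply/orP; left; apply/eqP; congr (_ * _).
  rewrite mulrCA; congr (_ * _).
  by rewrite addrC powRD ?(gt_eqF L0) ?implybT // powRr1 // ltW.
by rewrite mul1r [leRHS]mulrC ler_piMr // mulr_ge0 ?powR_ge0.
Qed.

End weighted.

(** * Dependence of the bounds on the noise level *)

Section rates.
Variable R : realType.
Implicit Types (x y z u v : R).

Lemma powRD_gt0 x u v : 0 < x -> x `^ (u + v) = x `^ u * x `^ v.
Proof. by move=> x0; rewrite powRD // (gt_eqF x0) implybT. Qed.

Lemma le_powR_base x y u : 0 <= u -> 0 <= x -> x <= y -> x `^ u <= y `^ u.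
Proof.
by move=> u0 x0 xy; apply: ge0_ler_powR; rewrite ?nnegrE // (le_trans x0).
Qed.

(** The absolute value is needed because ln L will carry the coefficient 1/p - 1/s, which may have
    either sign; [L0^-1] covers L < 1. *)
Lemma ln_abs_le L0 L : 0 < L0 -> L0 <= L -> `|ln L| <= L + L0^-1 :> R.
Proof.
move=> L00 L0L; have Lp : 0 < L by exact: lt_le_trans L0L.
rewrite ler_norml lerNl -lnV ?posrE //; apply/andP; split.
  apply: le_trans (ltW (ln_sublinear _)) _; rewrite ?invr_gt0 //.
  apply: (@le_trans _ _ L0^-1); first by rewrite lef_pV2 ?posrE.
  by rewrite lerDr ltW.
apply: le_trans (ltW (ln_sublinear Lp)) _.
by rewrite lerDl invr_ge0 ltW.
Qed.

(** [rp] and [si] stand for 1/p and 1/s, and [L0] bounds ln (1/delta) from below. The truncation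
    error decays like N^(-q) and the noise grows like N^(kappa - q), by [kq], up to logarithms. *)
Variables (q kappa rp si b C1 C2 L0 : R).
Hypothesis rp01 : 0 <= rp <= 1.
Hypothesis si01 : 0 <= si <= 1.
Hypothesis kappa0 : 0 < kappa.
Hypothesis q0 : 0 <= q.
Hypothesis kq : kappa - q = b + 1 - rp.
Hypothesis b0 : 0 <= b.
Hypothesis C10 : 0 < C1.
Hypothesis C20 : 0 < C2.
Hypothesis L00 : 0 < L0.

(** The prescribed size of n. Its power kappa is the inverse of [E], the base of the final rate, so
    powers of N become powers of [E]. *)
Let X (delta : R) := (delta^-1 * ln delta^-1 `^ (rp - si)) `^ kappa^-1.
Let E (delta : R) := delta * ln delta^-1 `^ (si - rp).

(** With L = ln (1/delta), kappa ln X is L plus a multiple of ln L, hence at most 2L + 1/L0. The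
    additive constants are absorbed into a multiple of L because L >= L0. *)
Lemma log_rate_le : exists2 C3, 0 < C3 & forall delta N : R,
  0 < delta -> L0 <= ln delta^-1 -> 1 <= N -> N <= C2 * X delta ->
  1 + ln N <= C3 * ln delta^-1.
Proof.
exists ((1 + `|ln C2| + L0^-1 / kappa) / L0 + 2 / kappa).
  rewrite addr_gt0 ?divr_gt0 // -addrA ltr_pwDl // addr_ge0 //.
  by rewrite divr_ge0 ?invr_ge0 ?(ltW L00) ?(ltW kappa0).
move=> delta N d0; set L := ln delta^-1 => L0L N1 NX.
have Lp : 0 < L by exact: lt_le_trans L0L.
have N0 : 0 < N by exact: lt_le_trans N1.
have X0 : 0 < X delta by rewrite powR_gt0 // mulr_gt0 ?invr_gt0 ?powR_gt0.
have h1 : ln N <= ln C2 + ln (X delta).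
  by rewrite -lnM ?posrE // ler_ln ?posrE // mulr_gt0.
have h2 : ln (X delta) <= (2 * L + L0^-1) / kappa.
  rewrite /X ln_powR mulrC ler_wpM2r ?invr_ge0 ?(ltW kappa0) //.
  rewrite lnM ?posrE ?powR_gt0 ?invr_gt0 // ln_powR -/L.
  rewrite mulr_natl mulr2n -addrA lerD2l; apply: le_trans (ler_norm _) _.
  rewrite normrM; apply: le_trans (ln_abs_le L00 L0L).
  have [[rp0 rp1] [si0 si1]] := (andP rp01, andP si01).
  by rewrite ler_piMl // ler_norml; lra.
have h3 : 1 + `|ln C2| + L0^-1 / kappa <= (1 + `|ln C2| + L0^-1 / kappa) / L0 * L.
  rewrite -mulrA ler_peMr ?addr_ge0 ?divr_ge0 ?invr_ge0 ?(ltW kappa0) ?(ltW L00) //.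
  by rewrite mulrC ler_pdivlMr // mul1r.
have h4 := ler_norm (ln C2).
rewrite mulrDl [2 / kappa * L]mulrAC; move: h2; rewrite mulrDl; lra.
Qed.

Lemma rates_le : exists2 c, 0 < c & forall delta N : R,
  0 < delta -> L0 <= ln delta^-1 -> 1 <= N -> C1 * X delta <= N -> N <= C2 * X delta ->
  let rate := E delta `^ (q / kappa) * ln delta^-1 `^ (3 / 2 - si) in
  N `^ (- q) * (1 + ln N) `^ (1 - si) <= c * rate /\
  N `^ b * (delta * (N * (1 + ln N)) `^ (1 - rp)) <= c * rate.
Proof.
have [C3 C30 HC3] := log_rate_le.
have [[rp0 rp1] [si0 si1]] := (andP rp01, andP si01).
set c1 := C1 `^ (- q) * C3 `^ (1 - si) * L0 `^ (- 2^-1).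
set c2 := C2 `^ (b + 1 - rp) * C3 `^ (1 - rp) * L0 `^ (- 2^-1).
have c10 : 0 < c1 by rewrite !mulr_gt0 ?powR_gt0.
have c20 : 0 < c2 by rewrite !mulr_gt0 ?powR_gt0.
exists (c1 + c2); first exact: addr_gt0.
move=> delta N d0 L0L N1 XN NX; set L := ln delta^-1 in L0L *.
have Lp : 0 < L by exact: lt_le_trans L0L.
have N0 : 0 < N by exact: lt_le_trans N1.
have E0 : 0 < E delta by rewrite mulr_gt0 ?powR_gt0.
have X0 : 0 < X delta by rewrite powR_gt0 // mulr_gt0 ?invr_gt0 ?powR_gt0.
have XE u : X delta `^ u = E delta `^ (- (u / kappa)).
  rewrite /X -/L (_ : delta^-1 * _ = E delta `^ (- 1)).
    by rewrite -!powRrM; congr (_ `^ _); field; rewrite gt_eqF.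
  by rewrite powR_inv1 ?(ltW E0) // /E invfM -powRN opprB.
have lnN : 1 + ln N <= C3 * L by exact: HC3.
have lnN0 : 0 <= 1 + ln N by rewrite addr_ge0 // ln_ge0.
(* The half power of the logarithm is given away here, for both contributions at once. *)
have Lsi : L `^ (1 - si) <= L0 `^ (- 2^-1) * L `^ (3 / 2 - si).
  rewrite (_ : 1 - si = - 2^-1 + (3 / 2 - si)); last by field.
  by rewrite powRD_gt0 // ler_wpM2r ?powR_ge0 // le_powRN.
set rate := E delta `^ (q / kappa) * L `^ (3 / 2 - si).
have rate0 : 0 <= rate by rewrite mulr_ge0 ?powR_ge0.
split.
  apply: (@le_trans _ _ (c1 * rate)); last by rewrite ler_wpM2r // lerDl ltW.
  apply: (@le_trans _ _ ((C1 * X delta) `^ (- q) * (C3 * L) `^ (1 - si))).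
    apply: ler_pM; [exact: powR_ge0|exact: powR_ge0| |].
      by apply: le_powRN; rewrite ?mulr_gt0.
    by apply: le_powR_base; rewrite ?subr_ge0.
  rewrite !powRM ?(ltW C10) ?(ltW X0) ?(ltW C30) ?(ltW Lp) // XE mulNr opprK.
  have -> : c1 * rate = C1 `^ (- q) * C3 `^ (1 - si) * E delta `^ (q / kappa) *
      (L0 `^ (- 2^-1) * L `^ (3 / 2 - si)) by rewrite /c1 /rate; ring.
  rewrite mulrACA -[leRHS]mulrA ler_wpM2l ?mulr_ge0 ?powR_ge0 //.
  by rewrite ler_wpM2l ?powR_ge0.
apply: (@le_trans _ _ (c2 * rate)); last by rewrite ler_wpM2r // lerDr ltW.
(* This factor turns the exponent 1 - rp of the logarithm in the noise into 1 - si, the same as in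
   the truncation error. *)
have dE : delta = E delta * L `^ (rp - si).
  by rewrite /E -mulrA -powRD_gt0 // (_ : si - rp + (rp - si) = 0) ?powRr0 ?mulr1 //; ring.
have -> : N `^ b * (delta * (N * (1 + ln N)) `^ (1 - rp)) =
    delta * N `^ (b + 1 - rp) * (1 + ln N) `^ (1 - rp).
  by rewrite powRM ?(ltW N0) // -addrA (powRD_gt0 b (1 - rp) N0); ring.
apply: (@le_trans _ _ (delta * (C2 * X delta) `^ (b + 1 - rp) * (C3 * L) `^ (1 - rp))).
  apply: ler_pM; [by rewrite mulr_ge0 ?powR_ge0 ?(ltW d0)|exact: powR_ge0| |].
    apply: ler_wpM2l; first exact: ltW.
    apply: le_powR_base; [by rewrite -addrA addr_ge0 ?subr_ge0|exact: ltW|exact: NX].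
  by apply: le_powR_base; rewrite ?subr_ge0.
rewrite !powRM ?(ltW C20) ?(ltW X0) ?(ltW C30) ?(ltW Lp) // XE -kq.
have -> : delta * (C2 `^ (kappa - q) * E delta `^ (- ((kappa - q) / kappa))) *
    (C3 `^ (1 - rp) * L `^ (1 - rp)) =
    C2 `^ (kappa - q) * C3 `^ (1 - rp) *
    (E delta `^ 1 * E delta `^ (- ((kappa - q) / kappa))) *
    (L `^ (rp - si) * L `^ (1 - rp)).
  by rewrite {1}dE powRr1 ?(ltW E0) //; ring.
rewrite -!powRD_gt0 // (_ : 1 - (kappa - q) / kappa = q / kappa); last first.
  by field; rewrite gt_eqF.
rewrite (_ : rp - si + (1 - rp) = 1 - si); last by ring.
have -> : c2 * rate = C2 `^ (kappa - q) * C3 `^ (1 - rp) * E delta `^ (q / kappa) *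
    (L0 `^ (- 2^-1) * L `^ (3 / 2 - si)) by rewrite /c2 /rate kq; ring.
by rewrite ler_wpM2l ?mulr_ge0 ?powR_ge0.
Qed.

End rates.

(** * Absolutely convergent series in L_p *)

Section Lnorm_series.
Local Open Scope classical_set_scope.
Local Open Scope classical_set_scope.
Local Open Scope ereal_scope.
Context d (T : measurableType d) (R : realType).
Variable mu : {measure set T -> \bar R}.
Variable p : R.
Hypothesis p1 : (1 <= p)%R.
Implicit Types (f g : T -> \bar R) (h : nat -> T -> R).

Let p0 : (0 < p)%R. Proof. exact: lt_le_trans p1. Qed.

Let pn0 : p != 0%R. Proof. by rewrite gt_eqF. Qed.

Lemma measurable_Lnorm_integrand f : measurable_fun [set: T] f ->
  measurable_fun [set: T] (fun x => `|f x| `^ p).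
Proof.
move=> mf; apply: (measurableT_comp (measurable_poweR p)).
exact: measurableT_comp mf.
Qed.

Lemma le_Lnorm f g : measurable_fun [set: T] f -> measurable_fun [set: T] g ->
  (forall x, `|f x| <= `|g x|) -> 'N[mu]_p%:E[f] <= 'N[mu]_p%:E[g].
Proof.
move=> mf mg fg; rewrite unlock; apply: gt0_ler_poweR.
- by rewrite invr_ge0 ltW.
- by rewrite in_itv /= leey integral_ge0 // => x _; exact: poweR_ge0.
- by rewrite in_itv /= leey integral_ge0 // => x _; exact: poweR_ge0.
apply: ge0_le_integral => //.
- by move=> x _; exact: poweR_ge0.
- exact: measurable_Lnorm_integrand.
- exact: measurable_Lnorm_integrand.
- by move=> x _; apply: gt0_ler_poweR; rewrite ?(ltW p0) ?in_itv /= ?leey ?abse_ge0 ?fg.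
Qed.

Lemma Lnorm_sum_le (I : Type) (s : seq I) (h : I -> T -> R) :
  (forall i, measurable_fun [set: T] (h i)) ->
  'N[mu]_p%:E[EFin \o (fun x => (\sum_(i <- s) h i x)%R)] <=
  \sum_(i <- s) 'N[mu]_p%:E[EFin \o h i].
Proof.
move=> mh; elim: s => [|a s IH].
  rewrite big_nil (_ : _ \o _ = cst 0); first by rewrite Lnorm0 // eqe gt_eqF.
  by apply/funext => x /=; rewrite big_nil.
rewrite big_cons; under eq_fun do rewrite big_cons.
apply: le_trans (leeD2l _ IH).
by apply: eminkowski; rewrite ?lee_fin //; exact: measurable_sum.
Qed.

(** Countable Minkowski inequality: the finite one bounds the partial sums uniformly, and monotone
    convergence applies to their p-th powers. The sum may be infinite at some points. *)
Lemma Lnorm_nneseries_le h : (forall n, measurable_fun [set: T] (h n)) ->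
  (forall n x, 0 <= h n x)%R ->
  'N[mu]_p%:E[(fun x => \sum_(0 <= n <oo) (h n x)%:E)] <=
  \sum_(0 <= n <oo) 'N[mu]_p%:E[EFin \o h n].
Proof.
move=> mh h0; set M := leRHS.
have M0 : 0 <= M by apply: nneseries_ge0 => n _ _; exact: Lnorm_ge0.
pose S n x := (\sum_(0 <= i < n) h i x)%R.
have S0 n x : (0 <= S n x)%R by apply: sumr_ge0.
have mS n : measurable_fun [set: T] (S n) by exact: measurable_sum.
have ndS x : nondecreasing_seq (S ^~ x).
  apply/nondecreasing_seqP => n; rewrite /S big_nat_recr //= lerDl; exact: h0.
have ndSp x : {homo (fun n => `|(S n x)%:E| `^ p) : n m / (n <= m)%N >-> n <= m}.
  move=> n m nm; apply: gt0_ler_poweR; rewrite ?(ltW p0) ?in_itv /= ?leey ?lee_fin ?normr_ge0 //.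
  by rewrite !ger0_norm // ndS.
have int_le n : \int[mu]_x (`|(S n x)%:E| `^ p) <= M `^ p.
  rewrite -(poweR_Lnorm mu (EFin \o S n)) ?gt_eqF //.
  apply: gt0_ler_poweR; rewrite ?(ltW p0) ?in_itv /= ?leey ?Lnorm_ge0 ?M0 //.
  apply: le_trans (Lnorm_sum_le (index_iota 0 n) mh) _.
  by apply: nneseries_lim_ge => i _ _; exact: Lnorm_ge0.
rewrite unlock -[leRHS](poweRe1 M0) -(mulfV pn0) poweRrM.
apply: gt0_ler_poweR.
- by rewrite invr_ge0 ltW.
- by rewrite in_itv /= leey integral_ge0 // => x _; exact: poweR_ge0.
- by rewrite in_itv /= leey poweR_ge0.
apply: (@le_trans _ _ (\int[mu]_x limn (fun n => `|(S n x)%:E| `^ p))).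
  apply: ge0_le_integral => //.
  - by move=> x _; exact: poweR_ge0.
  - apply: measurable_Lnorm_integrand.
    apply: ge0_emeasurable_sum => [k x _ _|k _]; first by rewrite lee_fin.
    exact/measurable_EFinP.
  - apply: (emeasurable_fun_cvg (fun n x => `|(S n x)%:E| `^ p)).
      by move=> n; apply: measurable_Lnorm_integrand; exact/measurable_EFinP.
    by move=> x _; apply: ereal_nondecreasing_is_cvgn; exact: ndSp.
  (* Continuity of the p-th power at infinity is avoided: if L is the limit of the p-th powers, each
     partial sum is at most L^(1/p), hence so is the series. *)
  - move=> x _.
    have Lx n : `|(S n x)%:E| `^ p <= limn (fun n => `|(S n x)%:E| `^ p).
      rewrite (cvg_lim _ (ereal_nondecreasing_cvgn (ndSp x))) //.
      by apply: ereal_sup_ubound; exists n.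
    move: (limn _) Lx => L Lx.
    have L0 : 0 <= L by apply: le_trans (Lx 0%N); exact: poweR_ge0.
    rewrite -[leRHS](poweRe1 L0) -(mulVf pn0) poweRrM.
    have G0 : 0 <= \sum_(0 <= n <oo) (h n x)%:E.
      by apply: nneseries_ge0 => n _ _; rewrite lee_fin.
    apply: gt0_ler_poweR; rewrite ?(ltW p0) ?in_itv /= ?leey ?abse_ge0 ?poweR_ge0 //.
    rewrite gee0_abs //; apply: lime_le.
      by apply: is_cvg_nneseries => n _ _; rewrite lee_fin.
    apply: nearW => n; rewrite sumEFin.
    rewrite -[leLHS](@poweRe1 _ _) ?lee_fin ?S0 // -(mulfV pn0) poweRrM.
    apply: gt0_ler_poweR; rewrite ?invr_ge0 ?(ltW p0) ?in_itv /= ?leey ?L0 ?poweR_ge0 //.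
      by rewrite andbT lee_fin powR_ge0.
    by have := Lx n; rewrite abse_EFin ger0_norm.
rewrite monotone_convergence //.
- apply: lime_le; last by apply: nearW.
  apply: ereal_nondecreasing_is_cvgn => n m nm; apply: ge0_le_integral => //.
  + by move=> x _; exact: poweR_ge0.
  + by apply: measurable_Lnorm_integrand; exact/measurable_EFinP.
  + by apply: measurable_Lnorm_integrand; exact/measurable_EFinP.
  + by move=> x _; exact: ndSp.
- by move=> n; apply: measurable_Lnorm_integrand; exact/measurable_EFinP.
- by move=> n x _; exact: poweR_ge0.
Qed.

(* The limit is [sum (|h| + h) - sum |h|].  Where [sum |h|] is infinite this is a
   junk value, but there the pointwise majorant [sum_(n >= N) |h n|] is infinite
   as well, so that no almost-everywhere argument is needed. *)
Lemma Lnorm_series_cvg h : (forall n, measurable_fun [set: T] (h n)) ->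
  exists2 g : T -> R, measurable_fun [set: T] g &
  forall N, 'N[mu]_p%:E[EFin \o (fun x => (g x - \sum_(0 <= i < N) h i x)%R)] <=
    \sum_(N <= n <oo) 'N[mu]_p%:E[EFin \o h n].
Proof.
move=> mh.
pose v n x := (`|h n x|)%R; pose u n x := (`|h n x| + h n x)%R.
have v0 n x : (0 <= v n x)%R by exact: normr_ge0.
have u0 n x : (0 <= u n x)%R by have := ler_norm (- h n x)%R; rewrite /u normrN; lra.
have mv n : measurable_fun [set: T] (v n) by exact: measurableT_comp (mh n).
have mu_ n : measurable_fun [set: T] (u n) by apply: measurable_funD; [exact: mv|exact: mh].
pose V N x := \sum_(N <= n <oo) (v n x)%:E.
pose U N x := \sum_(N <= n <oo) (u n x)%:E.
pose g x := (fine (U 0%N x) - fine (V 0%N x))%R.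
have mg : measurable_fun [set: T] g.
  apply: measurable_funB; apply: (measurableT_comp (f := fine)); rewrite ?fine_measurable //;
    by apply: ge0_emeasurable_sum => [k x _ _|k _]; rewrite ?lee_fin //; exact/measurable_EFinP.
exists g => // N.
have VN x : V N x = \sum_(0 <= n <oo) (v (n + N)%N x)%:E.
  by rewrite /V -(nneseries_addn (f := fun n => (v n x)%:E)) // => i; rewrite lee_fin.
apply: (@le_trans _ _ 'N[mu]_p%:E[V N]); last first.
  rewrite (_ : V N = fun x => \sum_(0 <= n <oo) (v (n + N)%N x)%:E); last exact/funext.
  apply: le_trans (Lnorm_nneseries_le _ _) _ => //.
  rewrite -(nneseries_addn (f := fun n => 'N[mu]_p%:E[EFin \o h n]));
    last by move=> i; exact: Lnorm_ge0.
  apply: lee_nneseries => [i _ _|n _]; first exact: Lnorm_ge0.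
  by rewrite -(Lnorm_abse _ (EFin \o h _)) le_eqVlt; apply/orP; left.
apply: le_Lnorm.
- apply/measurable_EFinP; apply: measurable_funB => //; exact: measurable_sum.
- rewrite (_ : V N = fun x => \sum_(0 <= n <oo) (v (n + N)%N x)%:E); last exact/funext.
  by apply: ge0_emeasurable_sum => [k x _ _|k _]; rewrite ?lee_fin //; exact/measurable_EFinP.
move=> x.
have VN0 : 0 <= V N x by apply: nneseries_ge0 => n _ _; rewrite lee_fin.
have UN0 : 0 <= U N x by apply: nneseries_ge0 => n _ _; rewrite lee_fin.
rewrite [leRHS]gee0_abs //.
have [->|Vfin] := eqVneq (V N x) +oo; first exact: leey.
(* From 0 <= U <= 2V it follows that |U - V| <= V, the majorant sought. *)
have UV : U N x <= V N x + V N x.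
  rewrite -nneseriesD; try by move=> *; rewrite lee_fin.
  apply: lee_nneseries => [i _ _|n _]; rewrite ?lee_fin //.
  by rewrite lerD2l ler_norm.
have Vf : V N x \is a fin_num by rewrite ge0_fin_numE // ltey.
have Uf : U N x \is a fin_num.
  by rewrite ge0_fin_numE // (le_lt_trans UV) // lte_add_pinfty // ltey.
have VS : V 0%N x = (\sum_(0 <= i < N) v i x)%R%:E + V N x.
  by rewrite /V (nneseries_split 0%N N) // ?add0n ?sumEFin // => k _; rewrite lee_fin.
have US : U 0%N x = (\sum_(0 <= i < N) u i x)%R%:E + U N x.
  by rewrite /U (nneseries_split 0%N N) // ?add0n ?sumEFin // => k _; rewrite lee_fin.
have gE : (g x - \sum_(0 <= i < N) h i x = fine (U N x) - fine (V N x))%R.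
  rewrite /g VS US !fineD //= /u big_split /=; ring.
rewrite [leLHS](_ : _ = `|(fine (U N x) - fine (V N x))%:E|); last by rewrite -gE.
move: UV UN0 VN0; rewrite -(fineK Vf) -(fineK Uf) -EFinD abse_EFin !lee_fin /=.
move=> UV UN0 VN0; rewrite ler_norml; lra.
Qed.

End Lnorm_series.

(** * Unconditional summation over a countable index set *)

Section unconditional.
Local Open Scope classical_set_scope.
Local Open Scope ereal_scope.
Context d (T : measurableType d) (R : realType).
Variable mu : {measure set T -> \bar R}.
Variable p : R.
Hypothesis p1 : (1 <= p)%R.
Variable I : countType.
Variables (H : I -> T -> R) (w : I -> R) (B : R).
Hypothesis mH : forall i, measurable_fun [set: T] (H i).
Hypothesis Hw : forall i, 'N[mu]_p%:E[EFin \o H i] <= (w i)%:E.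
Hypothesis wB : forall t : seq I, uniq t -> (\sum_(i <- t) w i <= B)%R.

(** The indices are enumerated and [t0] is an initial segment with a tail of weights below e/2. For
    a list containing [t0], the error is that of the partial sum plus extra terms from the tail,
    each at most e/2. *)
Lemma Lnorm_unconditional : exists2 g : T -> R, measurable_fun [set: T] g &
  forall e : R, (0 < e)%R -> exists t0 : seq I, forall t : seq I, uniq t ->
    {subset t0 <= t} ->
    'N[mu]_p%:E[EFin \o (fun x => (g x - \sum_(i <- t) H i x)%R)] <= e%:E.
Proof.
(* With [pickle_inv] each index occurs for exactly one n; the remaining n contribute the zero
   function. *)
pose h n x := oapp (H ^~ x) 0%R (pickle_inv n).
pose W n := oapp w 0%R (pickle_inv n : option I).
have w0 i : (0 <= w i)%R by rewrite -lee_fin; apply: le_trans (Hw i); exact: Lnorm_ge0.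
have W0 n : (0 <= W n)%R by rewrite /W; case: (pickle_inv n).
have mh n : measurable_fun [set: T] (h n).
  by rewrite /h; case: (pickle_inv n) => [i|] /=; [exact: mH|exact: measurable_cst].
have hW n : 'N[mu]_p%:E[EFin \o h n] <= (W n)%:E.
  rewrite /h /W; case: (pickle_inv n) => [i|] /=; first exact: Hw.
  by rewrite (_ : _ \o _ = cst 0) // Lnorm0 // eqe gt_eqF // (lt_le_trans _ p1).
have upick n : uniq (pmap (@pickle_inv I) (iota 0 n)).
  by apply: pmap_uniq (iota_uniq _ _); exact: pickle_invK.
have Wfin : \sum_(0 <= n <oo) (W n)%:E < +oo.
  apply: (@le_lt_trans _ _ B%:E); last exact: ltry.
  apply: lime_le; first by apply: is_cvg_nneseries => n _ _; rewrite lee_fin.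
  apply: nearW => n; rewrite sumEFin lee_fin.
  by rewrite /W -big_pmap /index_iota subn0 wB.
have [g mg gN] := Lnorm_series_cvg mu p1 mh.
exists g => // e e0.
have e20 : (0 < e / 2)%R by rewrite divr_gt0.
have [N WN] : exists N, \sum_(N <= n <oo) (W n)%:E <= (e / 2)%:E.
  have := @nneseries_tail_cvg R (fun n => (W n)%:E) xpredT Wfin (fun n _ => W0 n).
  move/fine_cvgP => [fin /cvgr_le /(_ _ e20)] /=.
  move=> hle; have [N _ /(_ N (leqnn N))[fN lN]] := filterI fin hle.
  by exists N; rewrite -(fineK fN) lee_fin.
exists (pmap (@pickle_inv I) (iota 0 N)) => t ut t0t.
have in0 i : (i \in pmap (@pickle_inv I) (iota 0 N)) = (choice.pickle i < N)%N.
  rewrite mem_pmap; apply/mapP/idP => [[n]|iN].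
    rewrite mem_iota add0n => /andP[_ nN] ni.
    by have := @pickle_invK I n; rewrite -ni /= => ->.
  by exists (choice.pickle i); rewrite ?mem_iota ?pickleK_inv.
pose t1 := [seq i <- t | choice.pickle i >= N]%N.
have tE x : (\sum_(i <- t) H i x = \sum_(0 <= n < N) h n x + \sum_(i <- t1) H i x)%R.
  rewrite /h -big_pmap /index_iota subn0 -big_cat /=.
  apply: perm_big; apply: uniq_perm => //.
    rewrite cat_uniq upick filter_uniq // andbT; apply/hasPn => i.
    by rewrite mem_filter in0 -ltnNge => /andP[].
  move=> i; rewrite mem_cat in0 mem_filter.
  by case: ltnP => //= iN; apply: t0t; rewrite in0.
apply: (@le_trans _ _ ('N[mu]_p%:E[EFin \o (fun x => (g x - \sum_(0 <= n < N) h n x)%R)] +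
   'N[mu]_p%:E[EFin \o (fun x => (\sum_(i <- t1) - H i x)%R)])).
  rewrite (_ : EFin \o _ = EFin \o ((fun x => (g x - \sum_(0 <= n < N) h n x)) \+
     (fun x => \sum_(i <- t1) - H i x))%R); last first.
    by apply/funext => x /=; rewrite tE sumrN opprD addrA.
  apply: eminkowski; rewrite ?lee_fin //.
    by apply: measurable_funB => //; exact: measurable_sum.
  by apply: measurable_sum => i; exact: measurableT_comp (mH i).
rewrite [e]splitr EFinD; apply: leeD.
  apply: le_trans (gN N) _; apply: le_trans WN.
  by apply: lee_nneseries => // n _ _; exact: Lnorm_ge0.
apply: (@le_trans _ _ (\sum_(i <- t1) w i)%:E).
  rewrite -sumEFin; apply: le_trans (Lnorm_sum_le mu p1 _ _) _.
    by move=> i; exact: measurableT_comp (mH i).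
  apply: lee_sum => i _; apply: le_trans (Hw i).
  by rewrite -(oppe_Lnorm mu (EFin \o H i)).
apply: le_trans WN.
have -> : (\sum_(i <- t1) w i = \sum_(n <- map choice.pickle t1) W n)%R.
  by rewrite big_map; apply: eq_bigr => i _; rewrite /W pickleK_inv.
pose M := (\max_(n <- map choice.pickle t1) n.+1)%N.
apply: (@le_trans _ _ (\sum_(N <= n < M) (W n)%:E)); last first.
  by apply: nneseries_lim_ge => n _ _; rewrite lee_fin.
rewrite sumEFin lee_fin; apply: sum_uniq_le => //.
  by rewrite map_inj_uniq ?filter_uniq //; exact: pcan_inj (@pickleK I).
move=> n nt1; rewrite mem_index_iota; apply/andP; split.
  by move: nt1 => /mapP[i]; rewrite mem_filter => /andP[iN _] ->.
exact: (@leq_bigmax_seq _ _ xpredT (fun n => n.+1)%N _ nt1).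
Qed.

End unconditional.

(** * Derivatives of Legendre polynomials *)

Section polynomial_integral.
Variable R : realType.
Implicit Types (p q : {poly R}) (c : R).

Lemma derivn_comp_shift p c n : p^`(n) \Po ('X + c%:P) = (p \Po ('X + c%:P))^`(n).
Proof.
elim: n => [|n IH]; first by rewrite !derivn0.
by rewrite !derivnS -IH deriv_comp derivD derivX derivC addr0 mulr1.
Qed.

Lemma derivn_horner p c n : p^`(n).[c] = (p \Po ('X + c%:P))`_n *+ n`!.
Proof.
have -> : p^`(n).[c] = (p^`(n) \Po ('X + c%:P)).[0].
  by rewrite horner_comp !hornerE.
by rewrite derivn_comp_shift horner_coef0 coef_derivn addn0 ffactnn.
Qed.

(** Shifting by c = 1 or -1 turns X^2 - 1 into X (X + 2c), so the Taylor coefficient can be read off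
    X^k (X + 2c)^k. If m - k > k the truncated exponent is harmless, as the binomial coefficient is
    0. *)
Lemma derivn_rodrigues k m c : c ^+ 2 = 1 ->
  (('X^2 - 1) ^+ k)^`(m).[c] =
  (if (m < k)%N then 0
   else (c *+ 2) ^+ (k - (m - k)) *+ 'C(k, m - k)) *+ m`!.
Proof.
move=> c1; rewrite derivn_horner; congr (_ *+ _).
have -> : (('X^2 - 1) ^+ k) \Po ('X + c%:P) =
    'X^k * ('X + (c *+ 2)%:P) ^+ k :> {poly R}.
  rewrite -exprMn rmorphXn /=; congr (_ ^+ _).
  have c1P : c%:P ^+ 2 = 1 :> {poly R} by rewrite -rmorphXn /= c1.
  rewrite rmorphB rmorph1 rmorphXn /= comp_polyX rmorphMn /= -[X in _ - X]c1P.
  by ring.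
rewrite coefXnM; case: ifP => // /negbT; rewrite -leqNgt => km.
have [mk|mk] := leqP (m - k) k; last first.
  rewrite bin_small // mulr0n; apply/leq_sizeP/leqnn.
  apply: leq_trans (size_poly_exp_leq _ _) _.
  by rewrite size_XaddC mul1n.
rewrite addrC exprDn coef_sum.
rewrite (bigD1 (inord (m - k))) //= inordK // big1 ?addr0.
  by rewrite -rmorphXn /= coefMn coefCM coefXn eqxx mulr1.
move=> i /eqP ik; rewrite -rmorphXn /= coefMn coefCM coefXn.
rewrite (_ : _ == _ = false) ?mulr0 ?mul0rn //; apply/negbTE/eqP => mki.
by apply: ik; apply: val_inj; rewrite /= inordK // ltnS.
Qed.

Lemma poly_integrable p :
  (@lebesgue_measure R).-integrable `[-1, 1]%classic (EFin \o horner p).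
Proof.
apply: continuous_compact_integrable; first exact: segment_compact.
by apply: continuous_subspaceT; exact: continuous_horner.
Qed.

Local Notation I p := (\int[@lebesgue_measure R]_(x in `[-1, 1]) p.[x]).

Lemma Rintegral_poly_deriv p : I p^`() = p.[1] - p.[-1].
Proof.
rewrite /Rintegral (@continuous_FTC2 _ (horner p^`()) (horner p)).
- by [].
- by lra.
- by apply: continuous_subspaceT; exact: continuous_horner.
- split.
  + by move=> x _; exact: derivable_horner.
  + by apply: cvg_at_right_filter; exact: continuous_horner.
  + by apply: cvg_at_left_filter; exact: continuous_horner.
- by move=> x _; rewrite derivE.
Qed.

Lemma Rintegral_polyD p q : I (p + q) = I p + I q.
Proof.
rewrite -RintegralD //; try exact: poly_integrable.
by apply: eq_Rintegral => x _; rewrite hornerD.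
Qed.

Lemma Rintegral_poly_parts p q :
  I (p^`() * q) = (p * q).[1] - (p * q).[-1] - I (p * q^`()).
Proof. by rewrite -Rintegral_poly_deriv derivM Rintegral_polyD addrK. Qed.


Lemma derivn_add p m n : p^`(m)^`(n) = p^`(m + n).
Proof. by rewrite addnC /derivn iterD. Qed.

Lemma size_derivn_leq p n : (size (p^`(n)) <= size p - n)%N.
Proof.
apply/leq_sizeP => i ni; rewrite coef_derivn nth_default ?mul0rn //.
by rewrite -leq_subLR.
Qed.

(** The boundary terms contain derivatives of order below k of (X^2 - 1)^k, which vanish at both
    endpoints. *)
Lemma Rintegral_rodrigues_parts k j q : (j <= k)%N ->
  I ((('X^2 - 1) ^+ k)^`(k) * q) =
  (-1) ^+ j * I ((('X^2 - 1) ^+ k)^`(k - j) * q^`(j)).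
Proof.
elim: j => [|j IH] jk; first by rewrite expr0 mul1r subn0 derivn0.
rewrite IH ?(ltnW jk) // (_ : (k - j = (k - j.+1).+1)%N) ?derivnS; last by lia.
rewrite Rintegral_poly_parts !hornerM.
by rewrite !derivn_rodrigues ?expr1n ?sqrrN ?expr1n ?ltn_subrL ?(leq_trans _ jk) //= !mul0rn !mul0r
  subrr sub0r (exprS (-1)) mulrN mulN1r mulNr.
Qed.

Lemma Rintegral_rodrigues_orth k q : (size q <= k)%N ->
  I ((('X^2 - 1) ^+ k)^`(k) * q) = 0.
Proof.
move=> qk; rewrite (Rintegral_rodrigues_parts q (leqnn k)) (derivn_poly0 qk) mulr0.
have -> : 0 = (0 : {poly R})^`() by rewrite deriv0.
by rewrite Rintegral_poly_deriv !horner0 subrr mulr0.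
Qed.

Lemma size_legendre k : (size (legendre R k) <= k.+1)%N.
Proof.
apply: leq_trans (size_scale_leq _ _) _; apply: leq_trans (size_derivn_leq _ _) _.
rewrite leq_subLR; apply: leq_trans (size_poly_exp_leq _ _) _.
set w := (X in size X); have : (size w <= 3)%N.
  by rewrite (leq_trans (size_polyD _ _)) // size_polyN size_polyXn size_poly1.
nia.
Qed.

Lemma Rintegral_legendre_orth k q : (size q <= k)%N -> I (legendre R k * q) = 0.
Proof.
move=> qk; rewrite /legendre -scalerAl scalerAr Rintegral_rodrigues_orth //.
exact: leq_trans (size_scale_leq _ _) qk.
Qed.

(** Up to sign and the factor sqrt(k + 1/2), the value is 2^(-m) C(k,m) (k+m)!/k!. Here C(k,m) <=
    k^m, and each of the m factors of (k+m)!/k! is at most (m+1)k. *)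
Lemma legendre_derivn_endpoint m k c : (0 < k)%N -> c ^+ 2 = 1 ->
  `|(legendre R k)^`(m).[c]| <=
  Num.sqrt (k%:R *+ 2) * (m.+1 ^ m * k ^ (m.*2))%:R.
Proof.
move=> k0 c1.
have nc : `|c| = 1 by have/eqP := c1; rewrite sqrf_eq1 => /orP[]/eqP->; rewrite ?normrN normr1.
rewrite /legendre derivnZ hornerZ derivn_add derivn_rodrigues // addKn.
rewrite ltnNge leq_addr /= normrM ger0_norm; last by rewrite divr_ge0 // mulr_ge0 ?exprn_ge0.
rewrite !normrMn normrX normrMn nc -mulrA ler_pM //.
- have k1 : 1 <= k%:R :> R by rewrite ler1n.
  by rewrite ler_sqrt; lra.
rewrite mulrC ler_pdivrMr; last by rewrite mulr_gt0 ?exprn_gt0 // ltr0n fact_gt0.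
have -> : 2 ^+ (k - m) *+ 'C(k, m) *+ (k + m)`! =
    (2 ^ (k - m) * 'C(k, m) * (k + m)`!)%:R :> R.
  by rewrite !natrM natrX !mulr_natr.
rewrite -natrX -!natrM ler_nat.
have [km|mk] := ltnP k m; first by rewrite bin_small // muln0 mul0n.
have h1 : (2 ^ (k - m) <= 2 ^ k)%N by rewrite leq_exp2l // leq_subr.
have h2 : ('C(k, m) <= k ^ m)%N.
  apply: (@leq_trans ('C(k, m) * m`!)); first by rewrite leq_pmulr // fact_gt0.
  rewrite bin_ffact ffact_prod -[X in (_ <= _ ^ X)%N]card_ord -prod_nat_const.
  by apply: leq_prod => i _; rewrite leq_subr.
have h3 i : (i <= m)%N -> ((k + i)`! <= k`! * (m.+1 * k) ^ i)%N.
  elim: i => [|i IH] im; first by rewrite addn0 muln1.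
  rewrite addnS factS expnS mulnCA leq_mul ?IH ?(ltnW im) //; nia.
have := h3 m (leqnn m); rewrite expnMn => {}h3.
rewrite -addnn expnD.
apply: leq_trans (leq_mul (leq_mul h1 h2) h3) _.
by apply: eq_leq; ring.
Qed.


(** The two orders add up to 2r - 1 for every i, so the power of k is always 1 + 2(2r - 1) = 4r - 1,
    the 1 coming from the two square roots. *)
Lemma legendre_derivn_endpointM r i k c : (i < r)%N -> (0 < k)%N -> c ^+ 2 = 1 ->
  `|((legendre R k)^`(r - i.+1) * (legendre R k)^`(r + i)).[c]| <=
  (2 * (2 * r) ^ (2 * r) * k ^ (4 * r - 1))%:R.
Proof.
move=> ir k0 c1; rewrite hornerM normrM.
apply: le_trans (ler_pM _ _ (legendre_derivn_endpoint _ k0 c1)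
  (legendre_derivn_endpoint _ k0 c1)) _; rewrite ?normr_ge0 //.
rewrite mulrACA -expr2 sqr_sqrtr ?mulrn_wge0 //.
rewrite -natrM -[k%:R *+ 2]mulr_natr -!natrM ler_nat.
rewrite (_ : (4 * r - 1 = 1 + ((r - i.+1).*2 + (r + i).*2))%N); last by lia.
rewrite !(expnD k) expn1.
have h : ((r - i.+1).+1 ^ (r - i.+1) * (r + i).+1 ^ (r + i) <= (2 * r) ^ (2 * r))%N.
  apply: (@leq_trans ((2 * r) ^ (r - i.+1) * (2 * r) ^ (r + i))).
    have mono a b e : (a <= b)%N -> (a ^ e <= b ^ e)%N.
      by case: e => // e; rewrite leq_exp2r.
    by rewrite leq_mul // mono; lia.
  by rewrite -expnD leq_pexp2l; lia.
move: h; move: (_ ^ (r - i.+1))%N (_ ^ (r + i))%N (_ ^ (2 * r))%N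
  (k ^ _)%N (k ^ _)%N => a b d e f h.
have := leq_mul (leqnn (k * 2 * (e * f))%N) h; lia.
Qed.

Lemma Rintegral_legendre_derivn_sqr r k : (0 < r)%N -> (0 < k)%N ->
  I ((legendre R k)^`(r) * (legendre R k)^`(r)) <=
  (4 * r * (2 * r) ^ (2 * r) * k ^ (4 * r - 1))%:R.
Proof.
move=> r0 k0; set B := (2 * (2 * r) ^ (2 * r) * k ^ (4 * r - 1))%N.
(* State after i integrations by parts: each has cost two endpoint values of size at most [B], and
   the absolute value absorbs the alternating sign. *)
have step i : (i <= r)%N -> I ((legendre R k)^`(r) * (legendre R k)^`(r)) <=
    (i * (2 * B))%:R + `|I ((legendre R k)^`(r - i) * (legendre R k)^`(r + i))|.
  elim: i => [|i IH] ir.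
    by rewrite mul0n add0r subn0 addn0 ler_norm.
  apply: le_trans (IH (ltnW ir)) _.
  rewrite (_ : (r - i = (r - i.+1).+1)%N); last by lia.
  rewrite derivnS Rintegral_poly_parts addnS derivnS.
  rewrite (mulSn i) natrD [X in _ <= X + _]addrC -[leRHS]addrA lerD2l.
  apply: le_trans (ler_normB _ _) _; rewrite lerD2r.
  apply: le_trans (ler_normB _ _) _; rewrite mulSn mul1n natrD lerD //;
    by apply: legendre_derivn_endpointM; rewrite ?sqrrN ?expr1n.
apply: le_trans (step r (leqnn r)) _.
(* At i = r the remaining integral pairs phi_k with a polynomial of degree below k. *)
rewrite subnn derivn0 Rintegral_legendre_orth ?normr0 ?addr0 ?ler_nat /B.
  by apply: eq_leq; ring.
apply: leq_trans (size_derivn_leq _ _) _.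
have := size_legendre k; rewrite leq_subLR => /leq_trans -> //; lia.
Qed.

End polynomial_integral.

(** * Tensor products on the square *)

Section tensor.
Local Open Scope classical_set_scope.
Variable R : realType.
Local Notation lam := (@lebesgue_measure R).
Implicit Types (p q : {poly R}).

Let tensor p q (z : R * R) : R := p.[z.1] * q.[z.2].

Lemma measurable_square : measurable (@square R).
Proof. exact: measurableX. Qed.

Lemma measurable_horner p : measurable_fun [set: R] (horner p).
Proof. by apply: continuous_measurable_fun; exact: continuous_horner. Qed.

Lemma measurable_tensor p q :
  measurable_fun [set: R * R] ((tensor p q) \_ (@square R)).
Proof.
apply/(measurable_restrictT _ measurable_square)/measurable_funTS.
apply: measurable_funM.
- exact: (measurableT_comp (measurable_horner p) measurable_fst).
- exact: (measurableT_comp (measurable_horner q) measurable_snd).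
Qed.

Lemma L2norm_tensor p q : (L2norm (tensor p q) =
  (Num.sqrt (\int[lam]_(x in `[-1, 1]) (p * p).[x] *
             \int[lam]_(x in `[-1, 1]) (q * q).[x]))%:E)%E.
Proof.
rewrite /L2norm unlock.
(* The indicator of the square is a product of interval indicators, so the squared integrand splits
   over the whole plane and Tonelli's theorem applies. *)
pose G (u : {poly R}) x := (((fun t => (u * u).[t]) \_ `[-1, 1]) x)%:E.
have mG u : measurable_fun [set: R] (G u).
  apply/measurable_EFinP/(measurable_restrictT _ (measurable_itv _)).
  apply/measurable_funTS; exact: measurable_horner.
have G0 u x : (0 <= G u x)%E.
  by rewrite /G lee_fin /patch; case: ifP => // _; rewrite hornerM -expr2 sqr_ge0.
have intG u : (\int[lam]_x G u x = (\int[lam]_(x in `[-1, 1]) (u * u).[x])%:E)%E.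
  rewrite /Rintegral fineK.
    rewrite integral_mkcond; apply: eq_integral => x _.
    by rewrite /G /patch; case: ifP.
  exact: (integrable_fin_num _ (poly_integrable (u * u))).
have -> : (\int[lam \x lam]_z `|(EFin \o (tensor p q \_ (@square R))) z| `^ 2 =
    \int[lam \x lam]_z (G p z.1 * G q z.2))%E.
  apply: eq_integral => -[x y] _.
  rewrite /G /tensor /square /=; congr EFin.
  rewrite powR_mulrn ?normr_ge0 // real_normK ?num_real // /patch.
  rewrite in_setX /=; case: (x \in _); case: (y \in _) => /=;
    rewrite ?hornerM ?mul0r ?mulr0 ?expr0n //; ring.
rewrite fubini_tonelli1; last 2 first.
- apply: emeasurable_funM.
    exact: (measurableT_comp (mG p) measurable_fst).
  exact: (measurableT_comp (mG q) measurable_snd).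
- by move=> z; rewrite mule_ge0.
have inner x : (\int[lam]_y (G p x * G q y) =
    G p x * (\int[lam]_(x in `[-1, 1]) (q * q).[x])%:E)%E.
  by rewrite (ge0_integralZl lam measurableT (mG q)) ?intG // => y _; exact: G0.
rewrite [X in (X `^ _)%E](_ : _ =
    \int[lam]_x (G p x * (\int[lam]_(x in `[-1, 1]) (q * q).[x])%:E))%E;
  last by apply: eq_integral => x _; exact: inner.
rewrite (ge0_integralZr lam measurableT (mG p)); first last.
- by rewrite lee_fin; apply: Rintegral_ge0 => x _; rewrite hornerM -expr2 sqr_ge0.
- by move=> x _; exact: G0.
rewrite intG -EFinM poweR_EFin powR12_sqrt // mulr_ge0 //;
  by apply: Rintegral_ge0 => x _; rewrite hornerM -expr2 sqr_ge0.
Qed.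

(** The coefficient is absorbed into the first factor. The exponent is half of 4r - 1, and each
    factor contributes a square root of the constant. *)
Lemma L2norm_legendre_derivn (c : R) r k j :
  (0 < r)%N -> (0 < k)%N -> (0 < j)%N ->
  (L2norm (fun z : R * R =>
     (c * legendre_derivn r k z.1 * legendre_derivn r j z.2)%R) <=
   ((4 * r * (2 * r) ^ (2 * r))%:R *
    (`|c| * (k * j)%:R `^ (2 * r%:R - 2^-1)))%:E)%E.
Proof.
move=> r0 k0 j0.
have -> : (fun z : R * R => c * legendre_derivn r k z.1 * legendre_derivn r j z.2) =
    tensor (c *: (legendre R k)^`(r)) (legendre R j)^`(r).
  by apply/funext => z; rewrite /tensor hornerZ.
rewrite L2norm_tensor lee_fin.
set K := (4 * r * _)%N.
have -> : K%:R * (`|c| * (k * j)%:R `^ (2 * r%:R - 2^-1)) = Num.sqrt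
   (c ^+ 2 * (K * k ^ (4 * r - 1))%:R * (K * j ^ (4 * r - 1))%:R) :> R.
  have -> : c ^+ 2 * (K * k ^ (4 * r - 1))%:R * (K * j ^ (4 * r - 1))%:R =
      (c * K%:R) ^+ 2 * (k * j)%:R ^+ (4 * r - 1) :> R.
    by rewrite [(k * j)%:R]natrM ![(K * _)%:R]natrM !natrX !exprMn; ring.
  rewrite sqrtrM ?sqr_ge0 //.
  rewrite sqrtr_sqr normrM (ger0_norm (ler0n _ _)) mulrCA mulrA.
  rewrite -powR_mulrn // -powR12_sqrt ?powR_ge0 // -powRrM.
  congr (_ * _ `^ _); rewrite natrB ?natrM; last by lia.
  by field.
have -> : \int[lam]_(x in `[-1, 1])
    ((c *: (legendre R k)^`(r)) * (c *: (legendre R k)^`(r))).[x] =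
    c ^+ 2 * \int[lam]_(x in `[-1, 1]) ((legendre R k)^`(r) * (legendre R k)^`(r)).[x].
  rewrite -RintegralZl //; last exact: poly_integrable.
  by apply: eq_Rintegral => x _; rewrite !hornerM !hornerZ; ring.
have sq0 q : 0 <= \int[lam]_(x in `[-1, 1]) (q * q).[x].
  by apply: Rintegral_ge0 => x _; rewrite hornerM -expr2 sqr_ge0.
rewrite ler_sqrt; last exact: (mulr_ge0 (mulr_ge0 (sqr_ge0 _) (ler0n _ _)) (ler0n _ _)).
apply: ler_pM; [by rewrite mulr_ge0 ?sqr_ge0|exact: sq0| |].
  by rewrite ler_wpM2l ?sqr_ge0 // Rintegral_legendre_derivn_sqr.
exact: Rintegral_legendre_derivn_sqr.
Qed.

End tensor.

(** * Mixed derivative and truncation *)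

Section mixed_derivative.
Local Open Scope classical_set_scope.
Variable R : realType.
Variable r : nat.
Hypothesis r0 : (0 < r)%N.
Implicit Types (a : nat -> nat -> R) (t : seq (nat * nat)) (f g : R * R -> R).

Local Notation P := (@lebesgue_measure R \x @lebesgue_measure R)%E.
Let b : R := 2 * r%:R - 2^-1.
Let K : R := (4 * r * (2 * r) ^ (2 * r))%:R.
Let term a (i : nat * nat) (z : R * R) : R :=
  a i.1 i.2 * legendre_derivn r i.1 z.1 * legendre_derivn r i.2 z.2.
Let weight a (i : nat * nat) : R := `|a i.1 i.2| * (i.1 * i.2)%:R `^ b.

Let le12 : (1 : R) <= 2. Proof. by rewrite ler1n. Qed.

Lemma le_L2norm f g : measurable_fun [set: R * R] (f \_ (@square R)) ->
  measurable_fun [set: R * R] g -> (forall z, `|(f \_ (@square R)) z| <= `|g z|) ->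
  (L2norm f <= 'N[P]_2%:E[EFin \o g])%E.
Proof.
move=> mf mg fg; apply: (le_Lnorm _ le12); [exact/measurable_EFinP|exact/measurable_EFinP|].
by move=> z; rewrite !abse_EFin lee_fin.
Qed.

Lemma measurable_term a i : measurable_fun [set: R * R] (term a i \_ (@square R)).
Proof.
rewrite (_ : term a i = fun z : R * R =>
  (a i.1 i.2 *: (legendre R i.1)^`(r)).[z.1] * (legendre R i.2)^`(r).[z.2]).
  exact: measurable_tensor.
by apply/funext => z; rewrite hornerZ.
Qed.

Lemma restrict_sum t (F : nat * nat -> R * R -> R) :
  (fun z => \sum_(i <- t) F i z) \_ (@square R) =
  (fun z => \sum_(i <- t) (F i \_ (@square R)) z).
Proof.
by apply/funext => z; rewrite /patch; case: ifP => // _; rewrite big1.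
Qed.

Lemma L2norm_term_sum a t :
  (forall i, i \in t -> (0 < i.1)%N && (0 < i.2)%N) ->
  (L2norm (fun z => (\sum_(i <- t) term a i z)%R) <=
    (K * \sum_(i <- t) weight a i)%:E)%E.
Proof.
move=> t0; rewrite /L2norm restrict_sum.
apply: le_trans (Lnorm_sum_le P le12 t (measurable_term a)) _.
rewrite mulr_sumr -sumEFin !big_seq; apply: lee_sum => i /t0 /andP[i1 i2].
exact: L2norm_legendre_derivn.
Qed.

Definition hyperbolic_cross (n : nat) : seq (nat * nat) :=
  [seq i <- [seq (k, j) | k <- index_iota r (r * n), j <- index_iota r (r * n)]
     | (i.1 * i.2 <= r * n - 1)%N].

Lemma mem_hyperbolic_cross n i : (0 < n)%N -> (i \in hyperbolic_cross n) =
  [&& (r <= i.1)%N, (r <= i.2)%N & (i.1 * i.2 < r * n)%N].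
Proof.
move=> n0; have N0 : (0 < r * n)%N by rewrite muln_gt0 r0.
rewrite mem_filter -ltnS subn1 prednK //; apply/andP/and3P.
  move=> [lt /allpairsP[[k j] /= [kI jI ikj]]]; rewrite ikj /= in lt *.
  by move: kI jI; rewrite !mem_index_iota => /andP[-> _] /andP[-> _].
case: i => k j /= [rk rj lt]; split => //; apply/allpairsP; exists (k, j).
have := leq_trans r0 rk; have := leq_trans r0 rj.
by rewrite !mem_index_iota rk rj /= => j0 k0; split => //; nia.
Qed.

Lemma hyperbolic_cross_uniq n : uniq (hyperbolic_cross n).
Proof.
apply: filter_uniq; apply: allpairs_uniq; rewrite ?iota_uniq //.
by move=> [? ?] [? ?] _ _ [-> ->].
Qed.

Lemma truncationE n a z :
  truncation r n a z = \sum_(i <- hyperbolic_cross n) term a i z.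
Proof.
rewrite /hyperbolic_cross big_filter [RHS]big_mkcond [RHS]big_allpairs /truncation.
by apply: eq_bigr => k _; rewrite [LHS]big_mkcond; apply: eq_bigr.
Qed.

Section smooth.
Variables (s mu : R) (f : R * R -> R).
Hypothesis s1 : 1 <= s.
Hypothesis q0 : 0 < mu - b + s^-1 - 1.
Hypothesis fs : (smooth_norm s mu f <= 1)%E.

Let q := mu - b + s^-1 - 1.
Let Ct := (1 + q^-1) + (1 + q^-1) ^+ 2 + 1.

Lemma fcoef_sum_le1 t : uniq t ->
  (forall i, i \in t -> (0 < i.1)%N && (0 < i.2)%N) ->
  \sum_(i <- t) (i.1 * i.2)%:R `^ (s * mu) * `|fcoef f i.1 i.2| `^ s <= 1.
Proof.
move=> ut t0; have s0 : 0 < s by exact: lt_le_trans s1.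
pose F (i : nat * nat) : R :=
  (maxn 1 (i.1 * i.2))%:R `^ (s * mu) * `|fcoef f i.1 i.2| `^ s.
have -> : \sum_(i <- t) (i.1 * i.2)%:R `^ (s * mu) * `|fcoef f i.1 i.2| `^ s =
    \sum_(i <- t) F i.
  apply: eq_big_seq => i /t0 i0; rewrite /F (maxn_idPr _) //.
  by rewrite muln_gt0.
rewrite -lee_fin; apply: le_trans (sum_le_esum _ ut) _.
have := poweR_inv_le s0 (ler01 : (0 : R) <= 1); rewrite powR1; apply => //.
by apply: esum_ge0 => i _; rewrite lee_fin mulr_ge0 ?powR_ge0.
Qed.

Lemma fcoef_tail_le t N : (0 < N)%N -> uniq t ->
  (forall i, i \in t -> (0 < i.1)%N && (0 < i.2)%N) ->
  (forall i, i \in t -> (N <= i.1 * i.2)%N) ->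
  \sum_(i <- t) weight (fcoef f) i <=
    Ct * (N%:R `^ (- q) * (1 + ln N%:R) `^ (1 - s^-1)).
Proof. by move=> N0 ut t0 tN; apply: (tail_sum_le s1 erefl) => //; exact: fcoef_sum_le1. Qed.

(** For N = 1 the tail bound covers all positive pairs, so the norms of the terms are summable and
    [Lnorm_unconditional] applies. *)
Lemma ex_mixed_derivative : exists g, is_mixed_derivative r f g.
Proof.
pose c (i : nat * nat) := (r <= i.1)%N && (r <= i.2)%N.
pose H i z := if c i then (term (fcoef f) i \_ (@square R)) z else 0.
pose w i := if c i then K * weight (fcoef f) i else 0.
have mH i : measurable_fun [set: R * R] (H i).
  by rewrite /H; case: (c i); [exact: measurable_term|exact: measurable_cst].
have cpos i : c i -> (0 < i.1)%N && (0 < i.2)%N.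
  by move=> /andP[i1 i2]; rewrite !(leq_trans r0).
have Hw i : ('N[P]_2%:E[EFin \o H i] <= (w i)%:E)%E.
  rewrite /H /w; case: ifP => [ci|_].
    by have /andP[i1 i2] := cpos i ci; exact: L2norm_legendre_derivn.
  by rewrite (_ : EFin \o _ = cst 0%E) // Lnorm0.
have wB t : uniq t -> \sum_(i <- t) w i <=
    K * (Ct * (1%:R `^ (- q) * (1 + ln 1%:R) `^ (1 - s^-1))).
  move=> ut; rewrite /w -big_mkcond -mulr_sumr ler_wpM2l // -big_filter.
  apply: fcoef_tail_le => //; first exact: filter_uniq.
    by move=> i; rewrite mem_filter => /andP[/cpos].
  by move=> i; rewrite mem_filter => /andP[/cpos i0 _]; rewrite muln_gt0.
have [g mg gP] := Lnorm_unconditional (mu := P) le12 mH Hw wB.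
have sumE t z : ((fun z => \sum_(i <- t | c i) term (fcoef f) i z) \_ (@square R)) z =
    \sum_(i <- t) H i z.
  rewrite /patch /H; case: ifP => zQ; rewrite big_mkcond //.
    by apply: eq_bigr => i _; case: (c i) => //; rewrite /patch zQ.
  by rewrite big1 // => i _; case: (c i) => //; rewrite /patch zQ.
have mgQ : measurable_fun [set: R * R] (g \_ (@square R)).
  apply/(measurable_restrictT _ (@measurable_square R)).
  exact: measurable_funTS.
have mS t : measurable_fun [set: R * R] (fun z => \sum_(i <- t) H i z).
  exact: measurable_sum.
exists g; split.
  rewrite /in_L2 inE; apply/andP; split; first by rewrite inE.
  rewrite inE /= /finite_norm.
  (* Square integrability of [g]: it is within distance 1 of a finite sum, and that sum has finite
     norm. *)
  have [t gt] := gP 1 ltr01.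
  apply: le_lt_trans (le_L2norm mgQ mg _) _.
    by move=> z; rewrite /patch; case: ifP => // _; rewrite normr0.
  rewrite (_ : g = (fun z => g z - \sum_(i <- undup t) H i z) \+
      (fun z => \sum_(i <- undup t) H i z)); last by apply/funext => z /=; rewrite subrK.
  have mgS t' := measurable_funB mg (mS t').
  have le12E : (1 <= (2 : R)%:E)%E by rewrite lee_fin.
  apply: le_lt_trans (eminkowski P (mgS _) (mS _) le12E) _.
  apply: lte_add_pinfty.
    apply: le_lt_trans (gt _ (undup_uniq t) _) (ltry _).
    by move=> i; rewrite mem_undup.
  apply: le_lt_trans (Lnorm_sum_le P le12 _ mH) _.
  by apply: lte_sum_pinfty => i _; exact: le_lt_trans (Hw i) (ltry _).
move=> e e0; have [t0 gt] := gP e e0.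
exists (seq_fset tt t0) => F /fsubsetP F0F.
have t0F : {subset t0 <= F}.
  by move=> i it; apply: F0F; rewrite seq_fsetE.
apply: le_trans (gt F (fset_uniq F) t0F).
have restrE : (fun z => g z - \sum_(i <- F | c i) term (fcoef f) i z) \_ (@square R) =
    (fun z => (g \_ (@square R)) z - \sum_(i <- F) H i z).
  by apply/funext => z; rewrite -sumE /patch; case: ifP; rewrite ?subrr.
apply: le_L2norm.
- by rewrite restrE; exact: measurable_funB.
- exact: measurable_funB.
- move=> z; rewrite restrE -sumE /patch; case: ifP => // _.
  by rewrite subr0 normr0.
Qed.

(** Up to an arbitrary e, [g] is a finite sum over some F that contains the hyperbolic cross. The
    pairs of F outside the cross satisfy kj >= rn and are bounded independently of F; on the cross
    only the noise remains. *)
Lemma L2norm_truncation_error_le g n x : (0 < n)%N ->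
  is_mixed_derivative r f g ->
  (L2norm (fun z => (g z - truncation r n x z)%R) <=
   (K * (Ct * ((r * n)%:R `^ (- q) * (1 + ln (r * n)%:R) `^ (1 - s^-1))
      + \sum_(i <- hyperbolic_cross n) weight (fun k j => fcoef f k j - x k j)%R i))%:E)%E.
Proof.
move=> n0 [gL2 gF]; apply/lee_addgt0Pr => e e0.
have [F0 F0P] := gF e e0.
pose F := (F0 `|` seq_fset tt (hyperbolic_cross n))%fset.
pose c (i : nat * nat) := (r <= i.1)%N && (r <= i.2)%N.
pose t := [seq i <- F | c i && (i \notin hyperbolic_cross n)].
pose y := (fun k j => fcoef f k j - x k j) : nat -> nat -> R.
have {}F0P := F0P F (fsubsetUl _ _).
have sumE z : \sum_(i <- F | c i) term (fcoef f) i z =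
    \sum_(i <- t) term (fcoef f) i z + \sum_(i <- hyperbolic_cross n) term (fcoef f) i z.
  rewrite -big_filter -big_cat; apply: perm_big; apply: uniq_perm.
  - exact: filter_uniq (fset_uniq F).
  - rewrite cat_uniq filter_uniq ?fset_uniq // hyperbolic_cross_uniq andbT.
    by apply/hasPn => i ih; rewrite mem_filter ih andbF.
  - move=> i; rewrite mem_cat [LHS]mem_filter [i \in t]mem_filter inE seq_fsetE.
    case: (boolP (i \in hyperbolic_cross n)) => ih; rewrite ?andbT ?andbF ?orbT ?orbF //=.
    by move: ih; rewrite mem_hyperbolic_cross // => /and3P[i1 i2 _]; rewrite /c i1 i2.
have ct i : i \in t -> (0 < i.1)%N && (0 < i.2)%N.
  by rewrite mem_filter => /andP[/andP[/andP[i1 i2] _] _]; rewrite !(leq_trans r0).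
have Nt i : i \in t -> (r * n <= i.1 * i.2)%N.
  rewrite mem_filter => /andP[/andP[/andP[i1 i2]]].
  by rewrite mem_hyperbolic_cross // i1 i2 /= -leqNgt.
have ch i : i \in hyperbolic_cross n -> (0 < i.1)%N && (0 < i.2)%N.
  by rewrite mem_hyperbolic_cross // => /and3P[i1 i2 _]; rewrite !(leq_trans r0).
pose S (u : seq (nat * nat)) a z := \sum_(i <- u) term a i z.
have mS u a : measurable_fun [set: R * R] ((S u a) \_ (@square R)).
  by rewrite restrict_sum; apply: measurable_sum => i; exact: measurable_term.
have mG : measurable_fun [set: R * R] (g \_ (@square R)).
  by have /sub_Lfun_mfun := gL2; rewrite inE.
have mD : measurable_fun [set: R * R]
    ((fun z => g z - \sum_(i <- F | c i) term (fcoef f) i z) \_ (@square R)).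
  rewrite (_ : _ \_ _ = fun z => (g \_ (@square R)) z -
      ((S t (fcoef f) \_ (@square R)) z + (S (hyperbolic_cross n) (fcoef f) \_ (@square R)) z)).
    by apply: measurable_funB => //; exact: measurable_funD.
  by apply/funext => z; rewrite /patch sumE; case: ifP; rewrite ?addr0 ?subrr.
have split3 : (fun z => g z - truncation r n x z) \_ (@square R) =
   ((fun z => g z - \sum_(i <- F | c i) term (fcoef f) i z) \_ (@square R)) \+
   ((S t (fcoef f) \_ (@square R)) \+ (S (hyperbolic_cross n) y \_ (@square R))).
  apply/funext => z; rewrite /= /patch; case: ifP; rewrite ?addr0 // => _.
  rewrite sumE truncationE.
  have -> : S (hyperbolic_cross n) y z = \sum_(i <- hyperbolic_cross n) term (fcoef f) i z
      - \sum_(i <- hyperbolic_cross n) term x i z.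
    by rewrite /S -sumrB; apply: eq_bigr => i _; rewrite /term /y; ring.
  by rewrite /S; ring.
rewrite {1}/L2norm split3.
have le12E : (1 <= (2 : R)%:E)%E by rewrite lee_fin.
apply: le_trans (eminkowski P mD (measurable_funD (mS t (fcoef f))
  (mS (hyperbolic_cross n) y)) le12E) _.
rewrite addeC; apply: leeD => //.
apply: le_trans (eminkowski P (mS _ _) (mS _ _) le12E) _.
rewrite mulrDr [leRHS]EFinD; apply: leeD.
  apply: (@le_trans _ _ (K * \sum_(i <- t) weight (fcoef f) i)%:E); first exact: L2norm_term_sum.
  rewrite lee_fin ler_wpM2l //.
  apply: fcoef_tail_le => //; first by rewrite muln_gt0 r0.
  exact: filter_uniq (fset_uniq F).
exact: L2norm_term_sum ch.
Qed.

End smooth.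
End mixed_derivative.

Lemma recip_ge0_le1 (R : realType) (p : \bar R) : (1 <= p)%E -> 0 <= recip p <= 1.
Proof.
case: p => [p| |] //; last by move=> _; rewrite recip_pinfty lexx ler01.
rewrite lee_fin => p1; have p0 : 0 < p by exact: lt_le_trans p1.
by rewrite recip_EFin // invr_ge0 ltW //= invf_le1.
Qed.

(** On the cross the weight is at most N^b with N = rn and comes out of the sum; N (1 + ln N) bounds
    the number of pairs. *)
Lemma hyperbolic_noise_le (R : realType) (r n : nat) (p : \bar R)
    (x : nat -> nat -> R) (delta b : R) :
  (0 < r)%N -> (0 < n)%N -> (1 <= p)%E -> 0 <= b -> 0 < delta ->
  (ell_norm p x <= delta%:E)%E ->
  \sum_(i <- hyperbolic_cross r n) `|x i.1 i.2| * (i.1 * i.2)%:R `^ b <=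
  2 * ((r * n)%:R `^ b *
    (delta * ((r * n)%:R * (1 + ln (r * n)%:R)) `^ (1 - recip p))).
Proof.
move=> r0 n0 p1 b0 d0 xd; have N0 : (0 < r * n)%N by rewrite muln_gt0 r0.
set N := (r * n)%N in N0 *; set M := N%:R * (1 + ln N%:R).
have M0 : 0 < M.
  by rewrite mulr_gt0 ?ltr0n // ltr_pwDl // ln_ge0 // ler1n.
have uhc := hyperbolic_cross_uniq r n.
have hcM : (size (hyperbolic_cross r n))%:R <= M.
  apply: hyperbolic_count_le => // i; rewrite mem_hyperbolic_cross //.
    by move=> /and3P[i1 i2 _]; rewrite !(leq_trans r0).
  by move=> /and3P[].
rewrite mulrCA; apply: le_trans (ler_wpM2l (powR_ge0 _ _)
  (noise_sum_le p1 d0 xd uhc M0 hcM)).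
rewrite mulr_sumr !big_seq; apply: ler_sum => i.
rewrite mem_hyperbolic_cross // => /and3P[_ _ iN].
rewrite mulrC ler_wpM2r // le_powR_base // ler_nat ltnW //.
Qed.

(** The order relation for n is expressed by [C1] and [C2], and [delta0] keeps ln (1/delta) away
    from 0, where its powers degenerate. The constant [c] is fixed before delta, n, f and the
    perturbed coefficients. *)
Theorem theorem0p2p5 (R : realType) (r : nat) (p : \bar R) (s mu : R)
    (hr : (1 <= r)%N) (hp : (1 <= p)%E) (hs : 1 <= s)
    (hmu : 2 * r%:R - s^-1 + 2^-1 < mu)
    (delta0 C1 C2 : R) (hdelta0 : 0 < delta0 < 1) (hC1 : 0 < C1) (hC2 : 0 < C2) :
  exists2 c : R, 0 < c &
  forall (delta : R) (n : nat) (f : R * R -> R) (fdelta : nat -> nat -> R),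
    0 < delta <= delta0 ->
    smooth_class s mu f ->
    (ell_norm p (fun k j => (fcoef f k j - fdelta k j)%R) <= delta%:E)%E ->
    C1 * (delta^-1 * ln delta^-1 `^ (recip p - s^-1))
           `^ (mu - recip p + s^-1)^-1 <= n%:R ->
    n%:R <= C2 * (delta^-1 * ln delta^-1 `^ (recip p - s^-1))
                   `^ (mu - recip p + s^-1)^-1 ->
    (exists g : R * R -> R, is_mixed_derivative r f g) /\
    (forall g : R * R -> R, is_mixed_derivative r f g ->
      (L2norm (fun z => (g z - truncation r n fdelta z)%R) <=
       (c * (delta * ln delta^-1 `^ (s^-1 - recip p))
              `^ ((mu - 2 * r%:R + s^-1 - 2^-1) / (mu - recip p + s^-1))
          * ln delta^-1 `^ (3 / 2 - s^-1))%:E)%E).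
Proof.
have /andP[d00 d01] := hdelta0.
have s0 : 0 < s by exact: lt_le_trans hs.
have si01 : 0 <= s^-1 <= 1 by rewrite invr_ge0 ltW //= invf_le1.
have rp01 := recip_ge0_le1 hp; have [rp0 rp1] := andP rp01.
have r1 : 1 <= r%:R :> R by rewrite ler1n.
have rR : 0 < r%:R :> R by rewrite ltr0n.
pose b : R := 2 * r%:R - 2^-1; have b0 : 0 <= b by rewrite /b; lra.
have q0 : 0 < mu - b + s^-1 - 1 by rewrite /b; lra.
pose kappa := mu - recip p + s^-1.
have k0 : 0 < kappa by rewrite /kappa /b in q0 *; lra.
have kq : kappa - (mu - b + s^-1 - 1) = b + 1 - recip p by rewrite /kappa /b; lra.
have L00 : 0 < ln delta0^-1 by rewrite ln_gt0 // invf_gt1.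
(* The constants are multiplied by r because the rates are applied to N = rn. *)
have [c0 c00 rates] := rates_le rp01 si01 k0 (ltW q0) kq b0
  (mulr_gt0 rR hC1) (mulr_gt0 rR hC2) L00.
set q := mu - b + s^-1 - 1 in q0 kq rates.
pose Ct := (1 + q^-1) + (1 + q^-1) ^+ 2 + 1.
have Ct0 : 0 < Ct by rewrite /Ct ltr_wpDl // addr_ge0 ?sqr_ge0 // addr_ge0 // invr_ge0 ltW.
pose K : R := (4 * r * (2 * r) ^ (2 * r))%:R.
have K0 : 0 < K by rewrite ltr0n !muln_gt0 expn_gt0 muln_gt0 hr.
(* [K] bounds the norms of the terms, [Ct] comes from the tail and 2 from the noise. *)
exists (K * ((Ct + 2) * c0)); first by rewrite !mulr_gt0 // addr_gt0.
move=> delta n f fdelta /andP[dp dd0] [_ fs] noise nlow nhigh.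
have L0L : ln delta0^-1 <= ln delta^-1 by rewrite ler_ln ?posrE ?invr_gt0 // lef_pV2.
have Lp : 0 < ln delta^-1 by exact: lt_le_trans L0L.
have n0 : (0 < n)%N.
  rewrite -(ltr_nat R); apply: lt_le_trans nlow.
  by rewrite mulr_gt0 // powR_gt0 // mulr_gt0 ?invr_gt0 // powR_gt0.
split; first exact: (ex_mixed_derivative hr hs q0 fs).
move=> g gP.
apply: le_trans (L2norm_truncation_error_le hr hs q0 fs fdelta n0 gP) _.
have N1 : 1 <= (r * n)%:R :> R by rewrite ler1n muln_gt0 hr.
have [] := rates delta (r * n)%:R dp L0L N1.
  by rewrite -mulrA natrM ler_wpM2l // ltW.
  by rewrite -mulrA natrM ler_wpM2l // ltW.
have -> : mu - 2 * r%:R + s^-1 - 2^-1 = q by rewrite /q /b; lra.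
rewrite -/kappa; set rate := (X in c0 * X) => tail_rate noise_rate.
rewrite lee_fin -!mulrA -/rate -/b -/K ler_wpM2l ?(ltW K0) // [leRHS]mulrDl; apply: lerD.
  by rewrite ler_wpM2l // ltW.
apply: le_trans (hyperbolic_noise_le hr n0 hp b0 dp noise) _.
by rewrite ler_wpM2l.
Qed.
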